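(* Let $f:A\longrightarrow C$ be a morphism of $\star$-Green $\mathcal{D}$-biset functors over $k$. Then $\mathcal{P}_f(\alpha^{\bullet})=\mathcal{P}_f(\alpha)^{\bullet}$ for all $\alpha\in\mathcal{P}_A(G,H)$ and all $G,H\in Ob(\mathcal{D})$, and $\mathcal{P}_f:Aut_{\mathcal{P}_A}(G)\longrightarrow Aut_{\mathcal{P}_C}(G)$ can be restricted to a group homomorphism $Aut_{\mathcal{P}_A}(G)^{\perp}\longrightarrow Aut_{\mathcal{P}_C}(G)^{\perp}$. Moreover, for all $G\in Ob(\mathcal{D})$ and all $N\unlhd G$ the following squares commute: $$\mathcal{P}_f(\widetilde{u})=\widetilde{f_G(u)}\ \text{ in } Aut_{\mathcal{P}_C}(G)^{\perp}\quad\text{for all } u\in A(G)^{\times,\perp},$$ $$\mathcal{P}_f\big(dAInf_{G/N}^G(\omega)\big)=dCInf_{G/N}^G\big(\mathcal{P}_f(\omega)\big)\ \text{ in } Aut_{\mathcal{P}_C}(G)^{\perp}\quad\text{for all }\omega\in Aut_{\mathcal{P}_A}(G/N)^{\perp}.$$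
   Context: All groups are finite; rings and algebras are associative and unital, with unit-preserving homomorphisms. Let $k$ be a commutative ring. $B(H,G)$ is the Burnside (Grothendieck) group of finite $(H,G)$-bisets (with $[X\sqcup Y]=[X]+[Y]$), and $B_k(H,G)=k\otimes B(H,G)$. The composition of a $(K,H)$-biset $Y$ and an $(H,G)$-biset $X$ is $Y\circ X=Y\times_H X$, the quotient of $Y\times X$ by $(yh,x)\sim(y,hx)$. The biset category $\mathcal{C}$ has all finite groups as objects, $Hom_{\mathcal{C}}(G,H)=B(H,G)$, composition $\circ$, and identity of $G$ the regular $(G,G)$-biset $G$. $\mathcal{D}\subseteq\mathcal{C}$ is a full subcategory whose objects are closed under subquotients and direct products; $k\mathcal{D}$ is its $k$-linearization. A $\mathcal{D}$-biset functor over $k$ is a $k$-linear functor $k\mathcal{D}\to {}_kMod$; morphisms are natural transformations. For a homomorphism $\phi:G\to H$: $Ind(\phi)$ is $H$ as an $(H,G)$-biset ($h'\cdot h\cdot g=h'h\phi(g)$), $Res(\phi)$ is $H$ as a $(G,H)$-biset ($g\cdot h\cdot h'=\phi(g)hh'$), and $Iso(\phi)=Ind(\phi)$ if $\phi$ is an isomorphism. $Inf_G^{G\times H}$ is $Res$ of the projection $G\times H\to G$. $\tau_{G,H}:G\times H\to H\times G$ is $(g,h)\mapsto(h,g)$, and $\Delta:G\to G\times G$ is $g\mapsto (g,g)$. For $N\unlhd G$ with projection $\pi:G\to G/N$, $Inf_{G/N}^G=Res(\pi)$ and $Def_{G/N}^G=Ind(\pi)$. A Green $\mathcal{D}$-biset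 functor over $k$ is a $\mathcal{D}$-biset functor $A$ such that each $A(G)$ is a $k$-algebra and, for each homomorphism $\phi:G\to H$ of groups in $Ob(\mathcal{D})$: $A(Res(\phi))$ is a $k$-algebra homomorphism, and $a\,A(Ind(\phi))(b)=A(Ind(\phi))(A(Res(\phi))(a)b)$, $A(Ind(\phi))(b)\,a=A(Ind(\phi))(b\,A(Res(\phi))(a))$ for $a\in A(H)$, $b\in A(G)$. A morphism of Green biset functors is a natural transformation whose components are $k$-algebra homomorphisms. For $a\in A(G)$, $b\in A(H)$ put $a\times b=A(Inf_G^{G\times H})(a)\,A(Inf_H^{G\times H})(b)\in A(G\times H)$, and let $\epsilon_A=1\in A(1)$. The Burnside functor $B_k$ ($B_k(G)$ is the $k$-linear Burnside ring of $G$, bisets acting by composition) is initial among Green biset functors; $e:B_k\to A$ is the unique morphism. The associated category $\mathcal{P}_A$ has objects $Ob(\mathcal{D})$, $Hom_{\mathcal{P}_A}(G,H)=\mathcal{P}_A(G,H)=A(H\times G)$, composition $\alpha\circ\beta=A(K\times\overleftarrow{H}\times G)(\alpha\times\beta)$ for $\alpha\in A(K\times H)$, $\beta\in A(H\times G)$, and identity $Id_G=A(\overrightarrow{G})(\epsilon_A)$. Here $\overrightarrow{G}$ is $G$ as a $(G\times G,1)$-biset via $(g_1,g_2)\cdot g=g_1gg_2^{-1}$, and $K\times\overleftarrow{H}\times G$ is the $(K\times G,K\times H\times H\times G)$-biset $K\times H\times G$ with $(k',g')\cdot(k,h,g)\cdot(k_1,h_1,h_2,g_1)=(k'kk_1,h_1^{-1}hh_2,g'gg_1)$.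 A morphism $f:A\to C$ of Green biset functors induces a $k$-linear functor $\mathcal{P}_f:\mathcal{P}_A\to\mathcal{P}_C$, identity on objects, $\mathcal{P}_f(\alpha)=f_{H\times G}(\alpha)$ for $\alpha\in\mathcal{P}_A(G,H)$. The map $\widetilde{\_}:A(G)\to End_{\mathcal{P}_A}(G)$ is $\widetilde{a}=A(Ind(\Delta))(a)$. An $(H,G)$-biset $X$ gives an $H\times G$-set $\overrightarrow{X}$ via $(h,g)\cdot x=hxg^{-1}$, extended $k$-linearly to $B_k(H,G)\to B_k(H\times G)$, $x\mapsto\overrightarrow{x}$. For $N\unlhd G$, the map $dAInf_{G/N}^G:Aut_{\mathcal{P}_A}(G/N)\to Aut_{\mathcal{P}_A}(G)$ is the group homomorphism $$\alpha\mapsto Id_G+e_{G\times G/N}\big(\overrightarrow{Inf_{G/N}^G}\big)\circ(\alpha-Id_{G/N})\circ e_{G/N\times G}\big(\overrightarrow{Def_{G/N}^G}\big),$$ which maps orthogonal automorphisms (defined below) to orthogonal ones; $dCInf_{G/N}^G$ is the same map for $C$. A $\star$-Green $\mathcal{D}$-biset functor is a Green $\mathcal{D}$-biset functor $A$ with a chosen anti-involution, i.e. an endomorphism $\_^{\star}:A\to A$ of biset functors with $a^{\star\star}=a$ and $(ab)^{\star}=b^{\star}a^{\star}$ for all $a,b\in A(G)$, $G\in Ob(\mathcal{D})$. A morphism of $\star$-Green biset functors is a morphism $f$ of Green biset functors with $f_G(a^{\star})=f_G(a)^{\star}$ for all $a\in A(G)$ and $G$. The duality of $A$ is the contravariant $k$-linear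 functor $\_^{\bullet}$ on $\mathcal{P}_A$, identity on objects, given by $\alpha^{\bullet}=A(Iso(\tau_{H,G}))(\alpha^{\star})\in A(G\times H)$ for $\alpha\in A(H\times G)$. A unit $u\in A(G)^{\times}$ is orthogonal if $u^{\star}=u^{-1}$; $A(G)^{\times,\perp}$ is the group of orthogonal units. An isomorphism $\omega$ in $\mathcal{P}_A$ is orthogonal if $\omega^{\bullet}=\omega^{-1}$; $Aut_{\mathcal{P}_A}(G)^{\perp}$ is the group of orthogonal automorphisms of $G$ in $\mathcal{P}_A$. *)

(* Defs.v *)
From HB Require Import structures.
From mathcomp Require Import all_boot all_order all_algebra all_fingroup.
From mathcomp Require Import boolp.

Set Implicit Arguments.
Unset Strict Implicit.
Unset Printing Implicit Defensive.

Import GRing.Theory.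
Local Open Scope ring_scope.
Local Open Scope quotient_scope.

Local Notation qrepr := generic_quotient.repr.

Section Presented.
Variables (k : pzRingType) (S : choiceType) (rel3 : S -> S -> S -> Prop).

Definition additive_on (M : lmodType k) (phi : S -> M) : Prop :=
  forall z x y, rel3 z x y -> phi z = phi x + phi y.

Definition lin_eval (M : lmodType k) (phi : S -> M) (s : seq (k * S)) : M :=
  \sum_(c <- s) c.1 *: phi c.2.

Definition pres_equiv (s t : seq (k * S)) : bool :=
  `[< forall (M : lmodType k) (phi : S -> M),
        additive_on phi -> lin_eval phi s = lin_eval phi t >].

Lemma pres_equiv_refl : reflexive pres_equiv.
Proof. by move=> s; apply/asboolP. Qed.

Lemma pres_equiv_sym : symmetric pres_equiv.
Proof.
by move=> s t; apply/asboolP/asboolP => h M phi /h ->.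
Qed.

Lemma pres_equiv_trans : transitive pres_equiv.
Proof.
move=> t s u /asboolP h1 /asboolP h2; apply/asboolP => M phi a.
by rewrite h1 ?h2.
Qed.

Canonical pres_equiv_rel :=
  EquivRel pres_equiv pres_equiv_refl pres_equiv_sym pres_equiv_trans.

(* The k-module generated by S subject to the relations z = x + y whenever
   rel3 z x y: formal k-linear combinations of elements of S, two of them
   being identified when they take the same value in every k-module under
   every map from S satisfying the relations. *)
Definition presented := {eq_quot pres_equiv_rel}.

HB.instance Definition _ := Choice.on presented.

Definition pgen (x : S) : presented := \pi_presented [:: (1, x)].
Definition padd (u v : presented) : presented :=
  \pi_presented (qrepr u ++ qrepr v).
Definition pscale (a : k) (u : presented) : presented :=
  \pi_presented [seq (a * c.1, c.2) | c <- qrepr u].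
Definition popp (u : presented) : presented := pscale (-1) u.

Definition plift (M : lmodType k) (phi : S -> M) (u : presented) : M :=
  lin_eval phi (qrepr u).

Lemma lin_eval_cat (M : lmodType k) (phi : S -> M) s t :
  lin_eval phi (s ++ t) = lin_eval phi s + lin_eval phi t.
Proof. by rewrite /lin_eval big_cat. Qed.

Lemma lin_eval_scale (M : lmodType k) (phi : S -> M) a s :
  lin_eval phi [seq (a * c.1, c.2) | c <- s] = a *: lin_eval phi s.
Proof.
rewrite /lin_eval big_map scaler_sumr.
by apply: eq_bigr => c _; rewrite scalerA.
Qed.

Lemma plift_pi (M : lmodType k) (phi : S -> M) s :
  additive_on phi -> plift phi (\pi_presented s) = lin_eval phi s.
Proof.
move=> a; rewrite /plift; case: piP => t /eqmodP /asboolP h.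
by rewrite h.
Qed.

Lemma presP (u v : presented) :
  (forall (M : lmodType k) (phi : S -> M),
     additive_on phi -> plift phi u = plift phi v) -> u = v.
Proof.
move=> h; rewrite -[u]reprK -[v]reprK; apply/eqmodP/asboolP => M phi a.
exact: h.
Qed.

Lemma plift_add0 (M : lmodType k) (phi : S -> M) : additive_on phi ->
  forall u v, plift phi (padd u v) = plift phi u + plift phi v.
Proof. by move=> a u v; rewrite /padd plift_pi // lin_eval_cat. Qed.

Lemma plift_scale0 (M : lmodType k) (phi : S -> M) : additive_on phi ->
  forall c u, plift phi (pscale c u) = c *: plift phi u.
Proof. by move=> a c u; rewrite /pscale plift_pi // lin_eval_scale. Qed.

Lemma plift_00 (M : lmodType k) (phi : S -> M) : additive_on phi ->
  plift phi (\pi_presented [::]) = 0.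
Proof. by move=> a; rewrite plift_pi // /lin_eval big_nil. Qed.

Lemma paddA : associative padd.
Proof. by move=> u v w; apply: presP => M phi a; rewrite !plift_add0 // addrA. Qed.
Lemma paddC : commutative padd.
Proof. by move=> u v; apply: presP => M phi a; rewrite !plift_add0 // addrC. Qed.
Lemma padd0 : left_id (\pi_presented [::]) padd.
Proof.
by move=> u; apply: presP => M phi a; rewrite plift_add0 // plift_00 // add0r.
Qed.
Lemma paddN : left_inverse (\pi_presented [::]) popp padd.
Proof.
move=> u; apply: presP => M phi a.
by rewrite plift_add0 // plift_00 // plift_scale0 // scaleN1r addNr.
Qed.

HB.instance Definition _ :=
  GRing.isZmodule.Build presented paddA paddC padd0 paddN.

Lemma pscaleA a b u : pscale a (pscale b u) = pscale (a * b) u.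
Proof. by apply: presP => M phi h; rewrite !plift_scale0 // scalerA. Qed.
Lemma pscale1 : left_id 1 pscale.
Proof. by move=> u; apply: presP => M phi h; rewrite plift_scale0 // scale1r. Qed.
Lemma pscaleDr : right_distributive pscale +%R.
Proof.
move=> a u v; apply: presP => M phi h.
by rewrite plift_scale0 // !plift_add0 // scalerDr !plift_scale0.
Qed.
Lemma pscaleDl u : {morph pscale^~ u : a b / a + b}.
Proof.
move=> a b; apply: presP => M phi h.
by rewrite plift_add0 // !plift_scale0 // scalerDl.
Qed.

HB.instance Definition _ := GRing.Zmodule_isLmodule.Build k presented
  pscaleA pscale1 pscaleDr pscaleDl.

Lemma plift_linear (M : lmodType k) (phi : S -> M) : additive_on phi ->
  forall a u v, plift phi (a *: u + v) = a *: plift phi u + plift phi v.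
Proof. by move=> h a u v; rewrite plift_add0 // plift_scale0. Qed.

Lemma plift_gen (M : lmodType k) (phi : S -> M) x :
  additive_on phi -> plift phi (pgen x) = phi x.
Proof. by move=> h; rewrite plift_pi // /lin_eval big_seq1 scale1r. Qed.

Lemma pgen_rel z x y : rel3 z x y -> pgen z = pgen x + pgen y.
Proof.
by move=> h; apply: presP => M phi a; rewrite plift_add0 // !plift_gen //; apply: a.
Qed.

Lemma pres_ind (P : presented -> Prop) :
  P 0 -> (forall a x u, P u -> P (a *: pgen x + u)) -> forall u, P u.
Proof.
move=> P0 PS u; rewrite -[u]reprK; elim: (qrepr u) => [//|[a x] s IHs].
suff -> : \pi_presented ((a, x) :: s) = a *: pgen x + \pi_presented s.
  exact: PS.
apply: presP => M phi h; rewrite plift_linear // plift_gen // !plift_pi //.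
by rewrite /lin_eval big_cons.
Qed.

End Presented.

Lemma lin_ext (k : pzRingType) (S : choiceType) (rel3 : S -> S -> S -> Prop)
    (M : lmodType k) (f g : presented k rel3 -> M) :
  linear f -> linear g -> (forall x, f (pgen k rel3 x) = g (pgen k rel3 x)) -> f =1 g.
Proof.
move=> lf lg fg; elim/pres_ind => [|a x u IH].
  have z0 (h : presented k rel3 -> M) : linear h -> h 0 = 0.
    by move=> lh; have := lh (-1) 0 0; rewrite scaler0 addr0 scaleN1r addNr.
  by rewrite !z0.
by rewrite lf lg fg IH.
Qed.

Record biset_on (H G : finGroupType) (T : Type) := BisetOn {
  lact_of : H -> T -> T;
  ract_of : T -> G -> T;
  lact1_of : forall x, lact_of 1%g x = x;
  lactM_of : forall h h' x, lact_of (h * h')%g x = lact_of h (lact_of h' x);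
  ract1_of : forall x, ract_of x 1%g = x;
  ractM_of : forall x g g', ract_of x (g * g')%g = ract_of (ract_of x g) g';
  lractA_of : forall h x g, ract_of (lact_of h x) g = lact_of h (ract_of x g) }.

Record biset (H G : finGroupType) := Biset {
  bcar :> finType;
  bstr : biset_on H G bcar }.

Section BisetBasics.
Variables H G : finGroupType.

Definition lact (X : biset H G) : H -> X -> X := lact_of (bstr X).
Definition ract (X : biset H G) : X -> G -> X := ract_of (bstr X).

Lemma lact1 (X : biset H G) (x : X) : lact 1%g x = x.
Proof. exact: lact1_of. Qed.
Lemma lactM (X : biset H G) h h' (x : X) : lact (h * h')%g x = lact h (lact h' x).
Proof. exact: lactM_of. Qed.
Lemma ract1 (X : biset H G) (x : X) : ract x 1%g = x.
Proof. exact: ract1_of. Qed.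
Lemma ractM (X : biset H G) g g' (x : X) : ract x (g * g')%g = ract (ract x g) g'.
Proof. exact: ractM_of. Qed.
Lemma lractA (X : biset H G) h (x : X) g : ract (lact h x) g = lact h (ract x g).
Proof. exact: lractA_of. Qed.

Lemma lactK (X : biset H G) h (x : X) : lact h^-1%g (lact h x) = x.
Proof. by rewrite -lactM mulVg lact1. Qed.
Lemma ractK (X : biset H G) (x : X) g : ract (ract x g) g^-1%g = x.
Proof. by rewrite -ractM mulgV ract1. Qed.

Definition biso (X Y : biset H G) : Prop :=
  exists f : X -> Y, [/\ bijective f, forall h x, f (lact h x) = lact h (f x)
                      & forall x g, f (ract x g) = ract (f x) g].

Lemma biso_refl X : biso X X.
Proof. by exists id; split => //; exists id. Qed.

Lemma biso_sym X Y : biso X Y -> biso Y X.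
Proof.
case=> f [[g fK gK] fl fr]; exists g; split; first by exists f.
  by move=> h y; rewrite -{1}[y]gK -fl fK.
by move=> y a; rewrite -{1}[y]gK -fr fK.
Qed.

Lemma biso_trans Y X Z : biso X Y -> biso Y Z -> biso X Z.
Proof.
case=> f [bf fl fr] [g [bg gl gr]]; exists (g \o f); split.
- exact: bij_comp.
- by move=> h x /=; rewrite fl gl.
- by move=> x a /=; rewrite fr gr.
Qed.

Definition bsum_on (X Y : biset H G) : biset_on H G (X + Y)%type.
Proof.
refine (@BisetOn H G (X + Y)%type
  (fun h u => match u with inl x => inl (lact h x) | inr y => inr (lact h y) end)
  (fun u g => match u with inl x => inl (ract x g) | inr y => inr (ract y g) end)
  _ _ _ _ _).
- by case=> x; rewrite lact1.
- by move=> h h' [] x; rewrite lactM.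
- by case=> x; rewrite ract1.
- by move=> [] x g g'; rewrite ractM.
- by move=> h [] x g; rewrite lractA.
Defined.
Definition bsum (X Y : biset H G) : biset H G := Biset (bsum_on X Y).

Lemma biso_sum X X' Y Y' : biso X X' -> biso Y Y' -> biso (bsum X Y) (bsum X' Y').
Proof.
case=> f [[f' fK f'K] fl fr] [g [[g' gK g'K] gl gr]].
exists (fun u => match u with inl x => inl (f x) | inr y => inr (g y) end); split.
- exists (fun u => match u with inl x => inl (f' x) | inr y => inr (g' y) end).
  + by case=> x; rewrite ?fK ?gK.
  + by case=> x; rewrite ?f'K ?g'K.
- by move=> h [] x /=; rewrite /lact /= -/(lact _ _) ?fl ?gl.
- by move=> [] x a /=; rewrite /ract /= -/(ract _ _) ?fr ?gr.
Qed.

(* Every finite biset is isomorphic to one whose underlying set is 'I_n;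
   these form a small set of representatives of all finite bisets. *)
Definition skel : Type := {n : nat & biset_on H G 'I_n}.
HB.instance Definition _ := gen_eqMixin skel.
HB.instance Definition _ := gen_choiceMixin skel.

Definition biset_of_skel (s : skel) : biset H G := Biset (projT2 s).

Definition skel_on (X : biset H G) : biset_on H G 'I_#|X|.
Proof.
refine (@BisetOn H G 'I_#|X|
  (fun h i => enum_rank (lact h (enum_val i)))
  (fun i g => enum_rank (ract (enum_val i) g)) _ _ _ _ _).
- by move=> i; rewrite lact1 enum_valK.
- by move=> h h' i; rewrite enum_rankK lactM.
- by move=> i; rewrite ract1 enum_valK.
- by move=> i g g'; rewrite enum_rankK ractM.
- by move=> h i g; rewrite !enum_rankK lractA.
Defined.
Definition skel_of_biset (X : biset H G) : skel := existT _ #|X| (skel_on X).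

Lemma skelK X : biso (biset_of_skel (skel_of_biset X)) X.
Proof.
exists (fun i : 'I_#|X| => enum_val i); split.
- by exists (@enum_rank X); [exact: enum_valK | exact: enum_rankK].
- by move=> h i; rewrite /lact /= enum_rankK.
- by move=> i g; rewrite /ract /= enum_rankK.
Qed.

Definition skel_rel (z x y : skel) : Prop :=
  biso (biset_of_skel z) (bsum (biset_of_skel x) (biset_of_skel y)).

End BisetBasics.

Section EmptyBiset.
Variables H G : finGroupType.

Definition bempty_on : biset_on H G void.
Proof. by refine (@BisetOn H G void (fun _ u => u) (fun u _ => u) _ _ _ _ _). Defined.
Definition bempty : biset H G := Biset bempty_on.

Lemma biso_addr0 (X : biset H G) : biso X (bsum X bempty).
Proof.
exists (fun x => inl x); split => //.
by exists (fun u : (X + void)%type => match u with inl x => x | inr v => match v with end end)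
  => [//|[x|[]]].
Qed.
End EmptyBiset.

Section Tensor.
Variables (K H G : finGroupType) (Y : biset K H) (X : biset H G).

Definition tens_equiv (p q : Y * X) : bool :=
  [exists h, (q.1 == ract p.1 h) && (p.2 == lact h q.2)].

Lemma tens_equivP p q :
  reflect (exists2 h, q.1 = ract p.1 h & p.2 = lact h q.2) (tens_equiv p q).
Proof.
apply: (iffP existsP) => [[h /andP[/eqP a /eqP b]]|[h a b]]; exists h => //.
by rewrite a b !eqxx.
Qed.

Lemma tens_equiv_refl : reflexive tens_equiv.
Proof. by move=> p; apply/tens_equivP; exists 1%g; rewrite ?ract1 ?lact1. Qed.

Lemma tens_equiv_sym : symmetric tens_equiv.
Proof.
have h p q : tens_equiv p q -> tens_equiv q p.
  case/tens_equivP => h a b; apply/tens_equivP; exists h^-1%g.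
    by rewrite a ractK.
  by rewrite b lactK.
by move=> p q; apply/idP/idP; apply: h.
Qed.

Lemma tens_equiv_trans : transitive tens_equiv.
Proof.
move=> q p r /tens_equivP[h a b] /tens_equivP[h' a' b'].
by apply/tens_equivP; exists (h * h')%g; rewrite ?ractM ?lactM -?a -?b' ?b.
Qed.

Canonical tens_equiv_rel :=
  EquivRel tens_equiv tens_equiv_refl tens_equiv_sym tens_equiv_trans.

Definition tens_car := {eq_quot tens_equiv_rel}.
HB.instance Definition _ := Choice.on tens_car.
HB.instance Definition _ := Countable.copy tens_car (can_type (@reprK _ tens_car)).
HB.instance Definition _ : isFinite tens_car := CanIsFinite (@reprK _ tens_car).

Definition tpair (y : Y) (x : X) : tens_car := \pi_tens_car (y, x).

Lemma tpairP y x y' x' :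
  (exists2 h, y' = ract y h & x = lact h x') <-> tpair y x = tpair y' x'.
Proof.
split=> [[h a b]|/eqmodP/tens_equivP [h a b]]; last by exists h.
by apply/eqmodP/tens_equivP; exists h.
Qed.

Lemma tpair_ract y h x : tpair (ract y h) x = tpair y (lact h x).
Proof. by symmetry; apply/tpairP; exists h. Qed.

Lemma tpair_ind (P : tens_car -> Prop) :
  (forall y x, P (tpair y x)) -> forall t, P t.
Proof. by move=> h t; rewrite -[t]reprK; case: (qrepr t) => y x; apply: h. Qed.

Definition tens_lact (a : K) (t : tens_car) : tens_car :=
  tpair (lact a (qrepr t).1) (qrepr t).2.
Definition tens_ract (t : tens_car) (g : G) : tens_car :=
  tpair (qrepr t).1 (ract (qrepr t).2 g).

Lemma tens_lactE a y x : tens_lact a (tpair y x) = tpair (lact a y) x.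
Proof.
rewrite /tens_lact; have := reprK (tpair y x); case: (qrepr _) => y' x' /=.
case/tpairP => h -> ->; apply/tpairP; exists h => //.
by rewrite lractA.
Qed.

Lemma tens_ractE y x g : tens_ract (tpair y x) g = tpair y (ract x g).
Proof.
rewrite /tens_ract; have := reprK (tpair y x); case: (qrepr _) => y' x' /=.
case/tpairP => h -> ->; apply/tpairP; exists h => //.
by rewrite lractA.
Qed.

Definition tens_on : biset_on K G tens_car.
Proof.
refine (@BisetOn K G tens_car tens_lact tens_ract _ _ _ _ _).
- by elim/tpair_ind => y x; rewrite tens_lactE lact1.
- by move=> a b; elim/tpair_ind => y x; rewrite !tens_lactE lactM.
- by elim/tpair_ind => y x; rewrite tens_ractE ract1.
- by elim/tpair_ind => y x a b; rewrite !tens_ractE ractM.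
- by move=> a; elim/tpair_ind => y x g; rewrite !(tens_lactE, tens_ractE).
Defined.

Definition tens : biset K G := Biset tens_on.

Lemma lact_tens a y x : lact a (tpair y x : tens) = tpair (lact a y) x.
Proof. exact: tens_lactE. Qed.
Lemma ract_tens y x g : ract (tpair y x : tens) g = tpair y (ract x g).
Proof. exact: tens_ractE. Qed.

Lemma biso_tens (Z : biset K G) (f : Y -> X -> Z) :
  (forall y h x, f (ract y h) x = f y (lact h x)) ->
  (forall y x y' x', f y x = f y' x' -> tpair y x = tpair y' x') ->
  (forall z, exists y x, f y x = z) ->
  (forall a y x, f (lact a y) x = lact a (f y x)) ->
  (forall y x g, f y (ract x g) = ract (f y x) g) ->
  biso tens Z.
Proof.
move=> fb fi fs fl fr.
pose F (t : tens) : Z := f (qrepr (t : tens_car)).1 (qrepr (t : tens_car)).2.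
have FE y x : F (tpair y x) = f y x.
  rewrite /F; have := reprK (tpair y x); case: (qrepr _) => y' x' /=.
  by case/tpairP => h -> ->; rewrite fb.
have Fi : injective F.
  elim/tpair_ind => y x; elim/tpair_ind => y' x'; rewrite !FE; exact: fi.
have Fs z : exists t, F t == z.
  by case: (fs z) => y [x <-]; exists (tpair y x); rewrite FE.
exists F; split.
- exists (fun z => xchoose (Fs z)) => [t|z]; last exact/eqP/(xchooseP (Fs z)).
  by apply: Fi; apply/eqP/(xchooseP (Fs (F t))).
- by move=> a; elim/tpair_ind => y x; rewrite lact_tens !FE fl.
- by elim/tpair_ind => y x a; rewrite ract_tens !FE fr.
Qed.

End Tensor.

Arguments tpair {K H G} Y X y x.

Section TensorTheory.
Variables K H G : finGroupType.

Lemma biso_tens2 (Y Y' : biset K H) (X X' : biset H G) :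
  biso Y Y' -> biso X X' -> biso (tens Y X) (tens Y' X').
Proof.
case=> f [[f' fK f'K] fl fr] [g [[g' gK g'K] gl gr]].
apply: (@biso_tens _ _ _ Y X (tens Y' X') (fun y x => tpair Y' X' (f y) (g x))).
- by move=> y h x; rewrite fr gl tpair_ract.
- move=> y x y' x' /tpairP[h a b]; apply/tpairP; exists h.
    by rewrite -[y']fK a -fr fK.
  by rewrite -[x]gK b -gl gK.
- elim/tpair_ind => y x; exists (f' y), (g' x); by rewrite f'K g'K.
- by move=> a y x; rewrite lact_tens fl.
- by move=> y x a; rewrite ract_tens gr.
Qed.

Lemma biso_tens_suml (Y Y' : biset K H) (X : biset H G) :
  biso (tens (bsum Y Y') X) (bsum (tens Y X) (tens Y' X)).
Proof.
apply: (@biso_tens _ _ _ (bsum Y Y') X (bsum (tens Y X) (tens Y' X))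
 (fun u x => match u with inl y => inl (tpair Y X y x) | inr y => inr (tpair Y' X y x) end)).
- by move=> [] y h x /=; congr (_ _); apply: tpair_ract.
- by move=> [] y x [] y' x' // [] /tpairP[h -> ->]; apply/tpairP; exists h.
- by case; elim/tpair_ind => y x; [exists (inl y), x | exists (inr y), x].
- by move=> a [] y x /=; congr (_ _); rewrite -lact_tens.
- by move=> [] y x a /=; congr (_ _); rewrite -ract_tens.
Qed.

Lemma biso_tens_sumr (Y : biset K H) (X X' : biset H G) :
  biso (tens Y (bsum X X')) (bsum (tens Y X) (tens Y X')).
Proof.
apply: (@biso_tens _ _ _ Y (bsum X X') (bsum (tens Y X) (tens Y X'))
 (fun y u => match u with inl x => inl (tpair Y X y x) | inr x => inr (tpair Y X' y x) end)).
- by move=> y h [] x /=; congr (_ _); apply: tpair_ract.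
- by move=> y [] x y' [] x' // [] /tpairP[h -> ->]; apply/tpairP; exists h.
- by case; elim/tpair_ind => y x; [exists y, (inl x) | exists y, (inr x)].
- by move=> a y [] x /=; congr (_ _); rewrite -lact_tens.
- by move=> y [] x a /=; congr (_ _); rewrite -ract_tens.
Qed.

Lemma biso_tensA (L : finGroupType) (Z : biset L K) (Y : biset K H) (X : biset H G) :
  biso (tens Z (tens Y X)) (tens (tens Z Y) X).
Proof.
apply: biso_sym.
pose F (t : tens Z Y) x : tens Z (tens Y X) :=
   tpair Z (tens Y X) (qrepr (t : tens_car Z Y)).1
                      (tpair Y X (qrepr (t : tens_car Z Y)).2 x).
have FE z y x : F (tpair Z Y z y) x = tpair Z (tens Y X) z (tpair Y X y x).
  rewrite /F; have := reprK (tpair Z Y z y); case: (qrepr _) => z' y' /=.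
  by case/tpairP => h -> ->; rewrite tpair_ract lact_tens.
apply: (biso_tens (f := F)).
- by elim/tpair_ind => z y h x; rewrite ract_tens !FE tpair_ract.
- elim/tpair_ind => z y x; elim/tpair_ind => z' y' x'.
  rewrite !FE => /tpairP[a ->]; rewrite lact_tens => /tpairP[h e ->].
  by apply/tpairP; exists h => //; rewrite ract_tens -e tpair_ract.
- by elim/tpair_ind => z; elim/tpair_ind => y x; exists (tpair Z Y z y), x.
- by move=> a; elim/tpair_ind => z y x; rewrite lact_tens !FE lact_tens.
- by elim/tpair_ind => z y x g; rewrite !FE !ract_tens.
Qed.
End TensorTheory.

Section BisetCategory.
Variable k : comPzRingType.

(* k (x) B(H,G): the k-module generated by the finite (H,G)-bisets subject to
   [Z] = [X] + [Y] whenever Z is isomorphic to the disjoint union of X and Y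
   (for Y empty this gives [Z] = [X] when Z and X are isomorphic). *)
Definition Bk (H G : finGroupType) : Type := presented k (@skel_rel H G).
HB.instance Definition _ H G := GRing.Lmodule.on (Bk H G).

Definition bcl (H G : finGroupType) (X : biset H G) : Bk H G :=
  pgen k (@skel_rel H G) (skel_of_biset X).

Definition bset_additive (H G : finGroupType) (M : lmodType k)
    (phi : biset H G -> M) : Prop :=
  forall Z X Y, biso Z (bsum X Y) -> phi Z = phi X + phi Y.

(* The k-linear extension to Bk H G of an additive map on bisets. *)
Definition blift (H G : finGroupType) (M : lmodType k)
    (phi : biset H G -> M) : Bk H G -> M :=
  plift (fun s : skel H G => phi (biset_of_skel s)).

Section Lift.
Variables (H G : finGroupType).

Lemma bset_additive_on (M : lmodType k) (phi : biset H G -> M) : bset_additive phi ->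
  additive_on (@skel_rel H G) (fun s : skel H G => phi (biset_of_skel s)).
Proof. by move=> a z x y /a. Qed.

Lemma bset_additive_iso (M : lmodType k) (phi : biset H G -> M) X Y :
  bset_additive phi -> biso X Y -> phi X = phi Y.
Proof.
move=> a i; have e : phi (bempty H G) = 0.
  by apply: (addrI (phi (bempty H G))); rewrite addr0 -(a _ _ _ (biso_addr0 _)).
by rewrite (a X Y (bempty H G)) ?e ?addr0 //; apply: biso_trans i (biso_addr0 _).
Qed.

Lemma blift_cl (M : lmodType k) (phi : biset H G -> M) X :
  bset_additive phi -> blift phi (bcl X) = phi X.
Proof.
move=> a; rewrite /blift /bcl plift_gen; last exact: bset_additive_on.
exact: bset_additive_iso a (skelK X).
Qed.

Lemma blift_linear (M : lmodType k) (phi : biset H G -> M) :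
  bset_additive phi -> linear (blift phi).
Proof. by move=> a c u v; apply: plift_linear; apply: bset_additive_on. Qed.

Lemma pgen_iso (s t : skel H G) : biso (biset_of_skel s) (biset_of_skel t) ->
  pgen k (@skel_rel H G) s = pgen k (@skel_rel H G) t.
Proof.
have E := skelK (bempty H G).
have e : pgen k (@skel_rel H G) (skel_of_biset (bempty H G)) = 0.
  apply: (addrI (pgen k (@skel_rel H G) (skel_of_biset (bempty H G)))).
  rewrite addr0 -(@pgen_rel k _ _ (skel_of_biset (bempty H G))) //.
  apply: (biso_trans E).
  by apply: biso_trans (biso_addr0 _) _; apply: biso_sym (biso_sum E E).
move=> i; rewrite (@pgen_rel k _ _ s t (skel_of_biset (bempty H G))) ?e ?addr0 //.
apply: biso_trans i _; apply: biso_trans (biso_addr0 _) _.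
exact: biso_sym (biso_sum (biso_refl _) E).
Qed.

Lemma bcl_add : bset_additive (@bcl H G).
Proof.
move=> Z X Y i; apply: pgen_rel; apply: biso_trans (skelK Z) _.
by apply: biso_trans i _; apply: biso_sym; apply: biso_sum; apply: skelK.
Qed.

Lemma bcl_iso (X Y : biset H G) : biso X Y -> bcl X = bcl Y.
Proof. exact/bset_additive_iso/bcl_add. Qed.

Lemma blin_ext (M : lmodType k) (f g : Bk H G -> M) :
  linear f -> linear g -> (forall X, f (bcl X) = g (bcl X)) -> f =1 g.
Proof.
move=> lf lg fg; apply: (lin_ext lf lg) => s.
suff -> : pgen k (@skel_rel H G) s = bcl (biset_of_skel s) by [].
exact/pgen_iso/biso_sym/skelK.
Qed.

End Lift.

(* The k-bilinear extension of an operation on bisets that is additive in each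
   argument. *)
Definition blift2 (H1 G1 H2 G2 H G : finGroupType)
    (op : biset H1 G1 -> biset H2 G2 -> biset H G)
    (y : Bk H1 G1) (x : Bk H2 G2) : Bk H G :=
  blift (fun Y => blift (fun X => bcl (op Y X)) x) y.

Section Bilinear.
Variables (H1 G1 H2 G2 H G : finGroupType).
Variable op : biset H1 G1 -> biset H2 G2 -> biset H G.
Hypothesis opl : forall Z Y Y' X,
  biso Z (bsum Y Y') -> biso (op Z X) (bsum (op Y X) (op Y' X)).
Hypothesis opr : forall Y Z X X',
  biso Z (bsum X X') -> biso (op Y Z) (bsum (op Y X) (op Y X')).

Let addr Y : bset_additive (fun X => bcl (op Y X)).
Proof. by move=> Z X X' i; apply: bcl_add; apply: opr. Qed.

Let addl x : bset_additive (fun Y => blift (fun X => bcl (op Y X)) x).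
Proof.
move=> Z Y Y' i; pose f Y x := blift (fun X => bcl (op Y X)) x.
have lf Y0 : linear (f Y0) by exact/blift_linear/addr.
have lg : linear (fun x => f Y x + f Y' x).
  by move=> a u v; rewrite !lf scalerDr -!addrA; congr (_ + _); rewrite addrCA.
apply: (blin_ext (lf Z) lg) => X; rewrite /f !(blift_cl _ (@addr _)).
by apply: bcl_add; apply: opl.
Qed.

Lemma blift2_cl Y X : blift2 op (bcl Y) (bcl X) = bcl (op Y X).
Proof. by rewrite /blift2 (blift_cl _ (@addl _)) (blift_cl _ (@addr _)). Qed.

Lemma blift2_linearl x : linear (fun y => blift2 op y x).
Proof. exact/blift_linear/addl. Qed.

Lemma blift2_linearr y : linear (fun x => blift2 op y x).
Proof.
move=> a u v; pose f y := blift2 op y (a *: u + v).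
pose g y := a *: blift2 op y u + blift2 op y v.
apply: (@blin_ext _ _ _ f g) => [||Y].
- exact: blift2_linearl.
- move=> b s t; rewrite /g !blift2_linearl !scalerDr !scalerA [b * a]mulrC -!addrA.
  by congr (_ + _); rewrite addrCA.
- have l := blift_linear (@addr Y).
  rewrite /f /g /blift2 !(blift_cl _ (@addl _)).
  exact: l.
Qed.
End Bilinear.

Definition bcomp (K H G : finGroupType) : Bk K H -> Bk H G -> Bk K G :=
  blift2 (@tens K H G).

Section Comp.
Variables K H G : finGroupType.

Lemma tens_addl (Z Y Y' : biset K H) (X : biset H G) :
  biso Z (bsum Y Y') -> biso (tens Z X) (bsum (tens Y X) (tens Y' X)).
Proof.
move=> i; apply: biso_trans (biso_tens_suml _ _ _).
exact: biso_tens2 i (biso_refl _).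
Qed.

Lemma tens_addr (Y : biset K H) (Z X X' : biset H G) :
  biso Z (bsum X X') -> biso (tens Y Z) (bsum (tens Y X) (tens Y X')).
Proof.
move=> i; apply: biso_trans (biso_tens_sumr _ _ _).
exact: biso_tens2 (biso_refl _) i.
Qed.

Lemma bcomp_cl (Y : biset K H) (X : biset H G) :
  bcomp (bcl Y) (bcl X) = bcl (tens Y X).
Proof. exact: blift2_cl tens_addl tens_addr _ _. Qed.

Lemma bcomp_linearl (x : Bk H G) : linear (fun y : Bk K H => bcomp y x).
Proof. exact: blift2_linearl tens_addl tens_addr _. Qed.

Lemma bcomp_linearr (y : Bk K H) : linear (fun x : Bk H G => bcomp y x).
Proof. exact: blift2_linearr tens_addl tens_addr _. Qed.
End Comp.

Definition breg_on (G : finGroupType) : biset_on G G G.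
Proof.
refine (@BisetOn G G G (fun h x => h * x)%g (fun x g => x * g)%g _ _ _ _ _).
- exact: mul1g.
- by move=> *; rewrite mulgA.
- exact: mulg1.
- by move=> *; rewrite mulgA.
- by move=> *; rewrite mulgA.
Defined.
Definition breg (G : finGroupType) : biset G G := Biset (breg_on G).

Lemma biso_tens1l (H G : finGroupType) (X : biset H G) : biso (tens (breg H) X) X.
Proof.
apply: (@biso_tens _ _ _ (breg H) X X (fun h x => lact h x)).
- by move=> y h x; rewrite lactM.
- move=> y x y' x' e; apply/tpairP; exists (y^-1 * y')%g.
    by rewrite /ract /= mulKVg.
  by rewrite lactM -e lactK.
- by move=> x; exists 1%g, x; rewrite lact1.
- by move=> a y x; rewrite -lactM.
- by move=> y x a; rewrite lractA.
Qed.

Lemma biso_tens1r (H G : finGroupType) (X : biset H G) : biso (tens X (breg G)) X.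
Proof.
apply: (@biso_tens _ _ _ X (breg G) X (fun x g => ract x g)).
- by move=> y h x; rewrite -ractM.
- move=> y x y' x' e; apply/tpairP; exists (x * x'^-1)%g.
    by rewrite ractM e ractK.
  by rewrite /lact /= mulgKV.
- by move=> x; exists x, 1%g; rewrite ract1.
- by move=> a y x; rewrite lractA.
- by move=> y x a; rewrite -ractM.
Qed.

Lemma bcompA (L K H G : finGroupType) (z : Bk L K) (y : Bk K H) (x : Bk H G) :
  bcomp z (bcomp y x) = bcomp (bcomp z y) x.
Proof.
apply: (@blin_ext _ _ _ (fun z => bcomp z (bcomp y x)) (fun z => bcomp (bcomp z y) x)).
- exact: bcomp_linearl.
- by move=> a u v; rewrite !bcomp_linearl.
move=> Z.
apply: (@blin_ext _ _ _ (fun y => bcomp (bcl Z) (bcomp y x))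
                        (fun y => bcomp (bcomp (bcl Z) y) x)).
- by move=> a u v; rewrite bcomp_linearl bcomp_linearr.
- by move=> a u v; rewrite bcomp_linearr bcomp_linearl.
move=> Y.
apply: (@blin_ext _ _ _ (fun x => bcomp (bcl Z) (bcomp (bcl Y) x))
                        (fun x => bcomp (bcomp (bcl Z) (bcl Y)) x)).
- by move=> a u v; rewrite !bcomp_linearr.
- exact: bcomp_linearr.
by move=> X; rewrite !bcomp_cl; apply/bcl_iso/biso_tensA.
Qed.

Lemma bcomp1l (H G : finGroupType) (x : Bk H G) : bcomp (bcl (breg H)) x = x.
Proof.
apply: (@blin_ext _ _ _ (fun x => bcomp (bcl (breg H)) x) id) => [||X] //.
  exact: bcomp_linearr.
by rewrite bcomp_cl; apply/bcl_iso/biso_tens1l.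
Qed.

Lemma bcomp1r (H G : finGroupType) (x : Bk H G) : bcomp x (bcl (breg G)) = x.
Proof.
apply: (@blin_ext _ _ _ (fun x => bcomp x (bcl (breg G))) id) => [||X] //.
  exact: bcomp_linearl.
by rewrite bcomp_cl; apply/bcl_iso/biso_tens1r.
Qed.

End BisetCategory.

Section Elementary.
Variables G H : finGroupType.

Section OfMorphism.
Variable phi : {multiplicative G -> H}.

Lemma mulf1 : phi 1%g = 1%g.
Proof. by apply: (mulgI (phi 1%g)); rewrite -gmulfM !mulg1. Qed.

Definition bind_on : biset_on H G H.
Proof.
refine (@BisetOn H G H (fun h x => h * x)%g (fun x g => x * phi g)%g _ _ _ _ _).
- exact: mul1g.
- by move=> *; rewrite mulgA.
- by move=> x; rewrite mulf1 mulg1.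
- by move=> *; rewrite gmulfM mulgA.
- by move=> *; rewrite mulgA.
Defined.
(* Ind(phi); it is also Iso(phi) when phi is bijective. *)
Definition bInd : biset H G := Biset bind_on.

Definition bres_on : biset_on G H H.
Proof.
refine (@BisetOn G H H (fun g x => phi g * x)%g (fun x h => x * h)%g _ _ _ _ _).
- by move=> x; rewrite mulf1 mul1g.
- by move=> *; rewrite gmulfM mulgA.
- exact: mulg1.
- by move=> *; rewrite mulgA.
- by move=> *; rewrite mulgA.
Defined.
Definition bRes : biset G H := Biset bres_on.
End OfMorphism.
End Elementary.

(* The group 1; a G-set is encoded as a (G,1)-biset. *)
Notation triv := ('I_1 : finGroupType).

Section Arrow.
Variables H G : finGroupType.

(* (h,g).x = h x g^-1 *)
Definition barrow_on (X : biset H G) : biset_on (H * G)%type triv X.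
Proof.
refine (@BisetOn (H * G)%type triv X
  (fun a x => ract (lact a.1 x) (a.2)^-1%g) (fun x _ => x) _ _ _ _ _).
- by move=> x; rewrite /= invg1 ract1 lact1.
- by move=> [h g] [h' g'] x; rewrite /= invMg ractM lactM !lractA.
- by [].
- by [].
- by [].
Defined.
Definition bset_arrow (X : biset H G) : biset (H * G)%type triv :=
  Biset (barrow_on X).

Lemma barrow_add (Z X Y : biset H G) : biso Z (bsum X Y) ->
  biso (bset_arrow Z) (bsum (bset_arrow X) (bset_arrow Y)).
Proof.
case=> f [bf fl fr]; exists f; split => // [[h g] z|z g].
  by rewrite {1}/lact /= fr fl; case: (f z).
by rewrite /ract /=; case: (f z).
Qed.

Definition barrow (k : comPzRingType) : Bk k H G -> Bk k (H * G)%type triv :=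
  blift (fun X => bcl k (bset_arrow X)).

Lemma barrow_cl (k : comPzRingType) (X : biset H G) :
  barrow (bcl k X) = bcl k (bset_arrow X).
Proof. by apply: blift_cl => Z X' Y /barrow_add; apply: bcl_add. Qed.
End Arrow.

(* The (K x G, K x H x H x G)-biset K x H x G with
   (k',g').(k,h,g).(k1,h1,h2,g1) = (k' k k1, h1^-1 h h2, g' g g1). *)
Section Middle.
Variables K H G : finGroupType.

Definition bmid_on :
  biset_on (K * G)%type ((K * H) * (H * G))%type (K * H * G)%type.
Proof.
refine (@BisetOn (K * G)%type ((K * H) * (H * G))%type (K * H * G)%type
  (fun a x => (a.1 * x.1.1, x.1.2, a.2 * x.2)%g)
  (fun x b => (x.1.1 * b.1.1, (b.1.2)^-1 * x.1.2 * b.2.1, x.2 * b.2.2)%g)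
  _ _ _ _ _).
- by move=> [[k h] g] /=; rewrite !mul1g.
- by move=> [a b] [a' b'] [[k h] g] /=; rewrite !mulgA.
- by move=> [[k h] g] /=; rewrite invg1 mul1g !mulg1.
- by move=> [[k h] g] [[a b] [c d]] [[a' b'] [c' d']] /=; rewrite invMg !mulgA.
- by move=> [a b] [[k h] g] [[a' b'] [c' d']] /=; rewrite !mulgA.
Defined.
Definition bmid : biset (K * G)%type ((K * H) * (H * G))%type := Biset bmid_on.
End Middle.

Definition gdiag (G : finGroupType) (g : G) : (G * G)%type := (g, g).
Lemma gdiagM (G : finGroupType) : {morph @gdiag G : x y / (x * y)%g}.
Proof. by []. Qed.
HB.instance Definition _ (G : finGroupType) :=
  isMultiplicative.Build G (G * G)%type (@gdiag G) (@gdiagM G).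

Definition gswap (G H : finGroupType) (p : G * H) : (H * G)%type := (p.2, p.1).
Lemma gswapM (G H : finGroupType) : {morph @gswap G H : x y / (x * y)%g}.
Proof. by []. Qed.
HB.instance Definition _ (G H : finGroupType) :=
  isMultiplicative.Build (G * H)%type (H * G)%type (@gswap G H) (@gswapM G H).

Section Projection.
Variables (G : finGroupType) (N : {group G}) (nN : (N <| [set: G])%g).
Definition qproj (_ : (N <| [set: G])%g) (g : G) : coset_of N := coset N g.
Lemma qprojM : {morph qproj nN : x y / (x * y)%g}.
Proof.
by move=> x y; apply: morphM; apply: (subsetP (normal_norm nN)); rewrite inE.
Qed.
HB.instance Definition _ :=
  isMultiplicative.Build G (coset_of N) (qproj nN) qprojM.

Definition bInf : biset G (coset_of N) := bRes (qproj nN).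
Definition bDef : biset (coset_of N) G := bInd (qproj nN).
End Projection.

(* The objects of D: a (nonempty) class of finite groups closed under
   subquotients, hence under isomorphism, and under direct products. *)
Record group_class := GroupClass {
  in_class :> finGroupType -> Prop;
  class_inh : exists G, in_class G;
  class_subquo : forall (G Q : finGroupType) (K L : {group G}),
    (L <| K)%g -> ([set: Q] \isog K / L)%g -> in_class G -> in_class Q;
  class_prod : forall G H : finGroupType,
    in_class G -> in_class H -> in_class (G * H)%type }.

Record dobj (D : group_class) := DObj {
  dgrp :> finGroupType;
  dgrpP : D dgrp }.

Section Objects.
Variable D : group_class.

Lemma class_triv : D triv.
Proof.
have [G DG] := class_inh D; apply: (class_subquo (normal_refl [1 G]%G) _ DG).
rewrite trivg_quotient; apply: trivial_isog => //; apply/trivgP/subsetP => x _.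
by rewrite inE; apply/eqP/val_inj; case: x => [[]].
Qed.

Lemma class_quo (G : finGroupType) (N : {group G}) :
  (N <| [set: G])%g -> D G -> D (coset_of N).
Proof. by move=> nN; apply: (class_subquo nN); rewrite quotientT; apply: isog_refl. Qed.

Definition dobj_triv : dobj D := DObj class_triv.
Definition dobj_prod (G H : dobj D) : dobj D := DObj (class_prod (dgrpP G) (dgrpP H)).
Definition dobj_quo (G : dobj D) (N : {group G}) (nN : (N <| [set: G])%g) : dobj D :=
  DObj (class_quo nN (dgrpP G)).
End Objects.

Arguments dobj_triv {D}.
Arguments dobj_quo {D} G {N} nN.

(* A k-linear functor from kD to k-modules with object map F. *)
Record bfunctor_on (k : comPzRingType) (D : group_class) (F : dobj D -> lmodType k) :=
  BFunctorOn {
    bmap : forall G H : dobj D, Bk k H G -> F G -> F H;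
    bmap_linear : forall (G H : dobj D) (x : Bk k H G), linear (bmap x);
    bmap_linear_biset : forall (G H : dobj D) (v : F G), linear (fun x : Bk k H G => bmap x v);
    bmap_id : forall G (v : F G), bmap (bcl k (breg G)) v = v;
    bmap_comp : forall (G H K : dobj D) (y : Bk k K H) (x : Bk k H G) (v : F G),
      bmap (bcomp y x) v = bmap y (bmap x v) }.

(* Associative unital k-algebras, the zero algebra being allowed (the algType
   of the library excludes it). *)
Record kalgebra (k : comPzRingType) := KAlgebra {
  kcar :> lmodType k;
  kmul : kcar -> kcar -> kcar;
  kone : kcar;
  kmulA : associative kmul;
  kmul1l : left_id kone kmul;
  kmul1r : right_id kone kmul;
  kmul_linearl : forall y, linear (fun x => kmul x y);
  kmul_linearr : forall x, linear (fun y => kmul x y) }.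

Record green (k : comPzRingType) (D : group_class) := Green {
  gobj :> dobj D -> kalgebra k;
  gfun : bfunctor_on (fun G => gobj G : lmodType k);
  gres_mul : forall (G H : dobj D) (phi : {multiplicative G -> H}) (a b : gobj H),
    bmap gfun (bcl k (bRes phi)) (kmul a b) =
    kmul (bmap gfun (bcl k (bRes phi)) a) (bmap gfun (bcl k (bRes phi)) b);
  gres_one : forall (G H : dobj D) (phi : {multiplicative G -> H}),
    bmap gfun (bcl k (bRes phi)) (kone (gobj H)) = kone (gobj G);
  gfrobl : forall (G H : dobj D) (phi : {multiplicative G -> H})
      (a : gobj H) (b : gobj G),
    kmul a (bmap gfun (bcl k (bInd phi)) b) =
    bmap gfun (bcl k (bInd phi)) (kmul (bmap gfun (bcl k (bRes phi)) a) b);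
  gfrobr : forall (G H : dobj D) (phi : {multiplicative G -> H})
      (a : gobj H) (b : gobj G),
    kmul (bmap gfun (bcl k (bInd phi)) b) a =
    bmap gfun (bcl k (bInd phi)) (kmul b (bmap gfun (bcl k (bRes phi)) a)) }.

Definition gmap (k : comPzRingType) (D : group_class) (A : green k D) (G H : dobj D) :
  Bk k H G -> A G -> A H := @bmap k D _ (gfun A) G H.

Section GreenTheory.
Variables (k : comPzRingType) (D : group_class) (A : green k D).

Lemma gmap_linear (G H : dobj D) (x : Bk k H G) : linear (gmap (A := A) x).
Proof. exact: bmap_linear. Qed.
Lemma gmap_linear_biset (G H : dobj D) (a : A G) :
  linear (fun x : Bk k H G => gmap x a).
Proof. exact: (bmap_linear_biset (gfun A)). Qed.
Lemma gmap_id (G : dobj D) (a : A G) : gmap (bcl k (breg G)) a = a.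
Proof. exact: bmap_id. Qed.
Lemma gmap_comp (G H K : dobj D) (y : Bk k K H) (x : Bk k H G) (a : A G) :
  gmap (bcomp y x) a = gmap y (gmap x a).
Proof. exact: bmap_comp. Qed.

Variables (G H : dobj D) (phi : {multiplicative G -> H}).
Lemma gmap_res_mul (a b : A H) : gmap (bcl k (bRes phi)) (kmul a b) =
  kmul (gmap (bcl k (bRes phi)) a) (gmap (bcl k (bRes phi)) b).
Proof. exact: gres_mul. Qed.
Lemma gmap_res_one : gmap (bcl k (bRes phi)) (kone (A H)) = kone (A G).
Proof. exact: gres_one. Qed.
Lemma gmap_frobl (a : A H) (b : A G) : kmul a (gmap (bcl k (bInd phi)) b) =
  gmap (bcl k (bInd phi)) (kmul (gmap (bcl k (bRes phi)) a) b).
Proof. exact: gfrobl. Qed.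
Lemma gmap_frobr (a : A H) (b : A G) : kmul (gmap (bcl k (bInd phi)) b) a =
  gmap (bcl k (bInd phi)) (kmul b (gmap (bcl k (bRes phi)) a)).
Proof. exact: gfrobr. Qed.
End GreenTheory.

Record green_mor (k : comPzRingType) (D : group_class) (A C : green k D) := GreenMor {
  gmor :> forall G : dobj D, A G -> C G;
  gmor_linear : forall G : dobj D, linear (@gmor G);
  gmor_nat : forall (G H : dobj D) (x : Bk k H G) (a : A G),
    @gmor H (gmap x a) = gmap x (@gmor G a);
  gmor_mul : forall (G : dobj D) (a b : A G),
    @gmor G (kmul a b) = kmul (@gmor G a) (@gmor G b);
  gmor_one : forall G : dobj D, @gmor G (kone (A G)) = kone (C G) }.

Arguments gmor {k D A C} _ G _.

Record star_green (k : comPzRingType) (D : group_class) := StarGreen {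
  sgreen :> green k D;
  star : forall G : dobj D, sgreen G -> sgreen G;
  star_linear : forall G : dobj D, linear (@star G);
  star_nat : forall (G H : dobj D) (x : Bk k H G) (a : sgreen G),
    star (gmap x a) = gmap x (star a);
  starK : forall (G : dobj D) (a : sgreen G), star (star a) = a;
  starM : forall (G : dobj D) (a b : sgreen G), star (kmul a b) = kmul (star b) (star a) }.

Record star_green_mor (k : comPzRingType) (D : group_class) (A C : star_green k D) :=
  StarGreenMor {
    smor :> green_mor A C;
    smor_star : forall (G : dobj D) (a : A G), smor G (star a) = star (smor G a) }.

Section BisetProduct.
Variables H G : finGroupType.

Definition bprod_on (X Y : biset H G) : biset_on H G (X * Y)%type.
Proof.
refine (@BisetOn H G (X * Y)%type
  (fun h p => (lact h p.1, lact h p.2)) (fun p g => (ract p.1 g, ract p.2 g))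
  _ _ _ _ _).
- by case=> x y; rewrite /= !lact1.
- by move=> h h' [x y]; rewrite /= !lactM.
- by case=> x y; rewrite /= !ract1.
- by case=> x y g g'; rewrite /= !ractM.
- by move=> h [x y] g; rewrite /= !lractA.
Defined.
Definition bprod (X Y : biset H G) : biset H G := Biset (bprod_on X Y).

Definition bpoint_on : biset_on H G unit.
Proof. by refine (@BisetOn H G unit (fun _ u => u) (fun u _ => u) _ _ _ _ _). Defined.
Definition bpoint : biset H G := Biset bpoint_on.

Lemma bprodC X Y : biso (bprod X Y) (bprod Y X).
Proof.
exists (fun p : X * Y => (p.2, p.1)); split => //.
by exists (fun p : Y * X => (p.2, p.1)) => [] [].
Qed.

Lemma bprodA X Y Z : biso (bprod X (bprod Y Z)) (bprod (bprod X Y) Z).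
Proof.
exists (fun p : X * (Y * Z) => ((p.1, p.2.1), p.2.2)); split => //.
by exists (fun p : (X * Y) * Z => (p.1.1, (p.1.2, p.2))) => [[? []]|[[]]].
Qed.

Lemma bprod1l X : biso (bprod bpoint X) X.
Proof.
exists (fun p : unit * X => p.2); split => //.
by exists (fun x => (tt, x)) => // [[[]]].
Qed.

Lemma bprod2 X X' Y Y' : biso X X' -> biso Y Y' -> biso (bprod X Y) (bprod X' Y').
Proof.
case=> f [[f' fK f'K] fl fr] [g [[g' gK g'K] gl gr]].
exists (fun p : X * Y => (f p.1, g p.2)); split.
- exists (fun p : X' * Y' => (f' p.1, g' p.2)).
  + by case=> x y; rewrite /= fK gK.
  + by case=> x y; rewrite /= f'K g'K.
- by move=> h [x y]; rewrite /= fl gl.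
- by move=> [x y] h; rewrite /= fr gr.
Qed.

Lemma bprod_sumr X Y Y' : biso (bprod X (bsum Y Y')) (bsum (bprod X Y) (bprod X Y')).
Proof.
exists (fun p : X * (Y + Y') =>
  match p.2 with inl y => inl (p.1, y) | inr y => inr (p.1, y) end); split.
- exists (fun q : (X * Y) + (X * Y') =>
    match q with inl p => (p.1, inl p.2) | inr p => (p.1, inr p.2) end).
  + by case=> x [].
  + by case=> -[].
- by move=> h [x []].
- by move=> [x []].
Qed.

Lemma bprod_addr Y Z X X' :
  biso Z (bsum X X') -> biso (bprod Y Z) (bsum (bprod Y X) (bprod Y X')).
Proof.
move=> i; apply: biso_trans (bprod_sumr _ _ _).
exact: bprod2 (biso_refl _) i.
Qed.

Lemma bprod_addl Z Y Y' X :
  biso Z (bsum Y Y') -> biso (bprod Z X) (bsum (bprod Y X) (bprod Y' X)).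
Proof.
move=> i; apply: (biso_trans (bprodC _ _)).
apply: (biso_trans (bprod_addr X i)).
by apply: biso_sum; apply: bprodC.
Qed.
End BisetProduct.

Section BurnsideRing.
Variables (k : comPzRingType) (H G : finGroupType).

Definition bmul : Bk k H G -> Bk k H G -> Bk k H G := blift2 (@bprod H G).
Definition bone : Bk k H G := bcl k (bpoint H G).

Lemma bmul_cl X Y : bmul (bcl k X) (bcl k Y) = bcl k (bprod X Y).
Proof. exact: blift2_cl (@bprod_addl _ _) (@bprod_addr _ _) _ _. Qed.
Lemma bmul_linearl y : linear (fun x => bmul x y).
Proof. exact: blift2_linearl (@bprod_addl _ _) (@bprod_addr _ _) _. Qed.
Lemma bmul_linearr x : linear (fun y => bmul x y).
Proof. exact: blift2_linearr (@bprod_addl _ _) (@bprod_addr _ _) _. Qed.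

Lemma bmulC x y : bmul x y = bmul y x.
Proof.
apply: (@blin_ext _ _ _ _ (fun x => bmul x y) (fun x => bmul y x)).
- exact: bmul_linearl.
- exact: bmul_linearr.
move=> X; apply: (@blin_ext _ _ _ _ (fun y => bmul (bcl k X) y)
                                    (fun y => bmul y (bcl k X))).
- exact: bmul_linearr.
- exact: bmul_linearl.
by move=> Y; rewrite !bmul_cl; apply/bcl_iso/bprodC.
Qed.

Lemma bmulA : associative bmul.
Proof.
move=> x y z.
apply: (@blin_ext _ _ _ _ (fun x => bmul x (bmul y z)) (fun x => bmul (bmul x y) z)).
- exact: bmul_linearl.
- by move=> a u v; rewrite !bmul_linearl.
move=> X; apply: (@blin_ext _ _ _ _ (fun y => bmul (bcl k X) (bmul y z))
                                    (fun y => bmul (bmul (bcl k X) y) z)).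
- by move=> a u v; rewrite bmul_linearl bmul_linearr.
- by move=> a u v; rewrite bmul_linearr bmul_linearl.
move=> Y; apply: (@blin_ext _ _ _ _ (fun z => bmul (bcl k X) (bmul (bcl k Y) z))
                                    (fun z => bmul (bmul (bcl k X) (bcl k Y)) z)).
- by move=> a u v; rewrite !bmul_linearr.
- exact: bmul_linearr.
by move=> Z; rewrite !bmul_cl; apply/bcl_iso/bprodA.
Qed.

Lemma bmul1l : left_id bone bmul.
Proof.
move=> x; apply: (@blin_ext _ _ _ _ (fun x => bmul bone x) id) => [||X] //.
  exact: bmul_linearr.
by rewrite bmul_cl; apply/bcl_iso/bprod1l.
Qed.

Lemma bmul1r : right_id bone bmul.
Proof. by move=> x; rewrite bmulC bmul1l. Qed.

Definition burnside_ring : kalgebra k :=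
  KAlgebra bmulA bmul1l bmul1r bmul_linearl bmul_linearr.
End BurnsideRing.

Section BurnsideGreen.
Variables (G H L : finGroupType) (phi : {multiplicative G -> H}).

Definition brestr_on (X : biset H L) : biset_on G L X.
Proof.
refine (@BisetOn G L X (fun g x => lact (phi g) x) (fun x l => ract x l) _ _ _ _ _).
- by move=> x; rewrite mulf1 lact1.
- by move=> g g' x; rewrite gmulfM lactM.
- exact: ract1.
- by move=> *; rewrite ractM.
- by move=> *; rewrite lractA.
Defined.
Definition brestr (X : biset H L) : biset G L := Biset (brestr_on X).

Lemma biso_tens_res (X : biset H L) : biso (tens (bRes phi) X) (brestr X).
Proof.
apply: (@biso_tens _ _ _ (bRes phi) X (brestr X) (fun h x => lact h x)).
- by move=> y h x; apply: (@lactM _ _ X y h x).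
- move=> y x y' x' e; apply/tpairP; exists (y^-1 * y')%g.
    by rewrite /ract /= mulKVg.
  by rewrite [RHS]lactM -e lactK.
- by move=> x; exists 1%g, x; rewrite lact1.
- by move=> a y x; apply: (@lactM _ _ X (phi a) y x).
- by move=> y x a; apply/esym/(@lractA _ _ X y x a).
Qed.

Lemma biso_res_prod (X Y : biset H L) :
  biso (tens (bRes phi) (bprod X Y)) (bprod (tens (bRes phi) X) (tens (bRes phi) Y)).
Proof.
apply: (biso_trans (biso_tens_res _)).
apply: (biso_trans (Y := bprod (brestr X) (brestr Y))).
  by exists id; split => //; exists id.
by apply: bprod2; apply: biso_sym; apply: biso_tens_res.
Qed.

Lemma biso_res_point : biso (tens (bRes phi) (bpoint H L)) (bpoint G L).
Proof.
by apply: (biso_trans (biso_tens_res _)); exists id; split => //; exists id.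
Qed.

Lemma biso_frob (X : biset H L) (Y : biset G L) :
  biso (bprod X (tens (bInd phi) Y))
       (tens (bInd phi) (bprod (tens (bRes phi) X) Y)).
Proof.
apply: biso_sym; apply: (biso_trans (Y := tens (bInd phi) (bprod (brestr X) Y))).
  by apply: biso_tens2 (biso_refl _) _; apply: bprod2 (biso_refl _); apply: biso_tens_res.
apply: (@biso_tens _ _ _ (bInd phi) (bprod (brestr X) Y) (bprod X (tens (bInd phi) Y))
  (fun h p => (lact h p.1, tpair (bInd phi) Y h p.2))).
- by move=> h g [x y]; rewrite /= tpair_ract; congr (_, _); apply: (@lactM _ _ X h (phi g) x).
- move=> h [x y] h' [x' y'] /= [ex] /tpairP[g eh ey].
  apply/tpairP; exists g => //; rewrite ey; congr (_, _).
  rewrite -[LHS](lactK h x) ex eh.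
  apply: etrans (lactK h (lact (phi g) x')); congr (lact _ _).
  exact: (@lactM _ _ X h (phi g) x').
- case=> x; elim/tpair_ind => h y.
  by exists h, (lact h^-1%g x, y); rewrite /= -lactM mulgV lact1.
- by move=> a h [x y]; rewrite /= -lact_tens; congr (_, _); apply: (@lactM _ _ X a h x).
- by move=> h [x y] l; rewrite /= -ract_tens; congr (_, _); apply/esym/(@lractA _ _ X h x l).
Qed.
End BurnsideGreen.

Section BurnsideFunctor.
Variables (k : comPzRingType) (D : group_class).

Definition burnside_fun :
  bfunctor_on (fun G : dobj D => burnside_ring k G triv : lmodType k).
Proof.
refine (@BFunctorOn k D (fun G : dobj D => burnside_ring k G triv)
  (fun G H => @bcomp k H G triv) _ _ _ _).
- by move=> G H x; apply: bcomp_linearr.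
- by move=> G H x; apply: bcomp_linearl.
- by move=> G v; apply: bcomp1l.
- by move=> G H K y x v; rewrite bcompA.
Defined.

Lemma burnside_res_mul (G H : finGroupType) (phi : {multiplicative G -> H})
    (a b : Bk k H triv) :
  bcomp (bcl k (bRes phi)) (bmul a b) =
  bmul (bcomp (bcl k (bRes phi)) a) (bcomp (bcl k (bRes phi)) b).
Proof.
pose r := bcomp (G := triv) (bcl k (bRes phi)).
have lr : linear r by apply: bcomp_linearr.
apply: (@blin_ext _ _ _ _ (fun a => r (bmul a b)) (fun a => bmul (r a) (r b))).
- by move=> c u v; rewrite bmul_linearl lr.
- by move=> c u v; rewrite lr bmul_linearl.
move=> X; apply: (@blin_ext _ _ _ _ (fun b => r (bmul (bcl k X) b))
                                    (fun b => bmul (r (bcl k X)) (r b))).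
- by move=> c u v; rewrite bmul_linearr lr.
- by move=> c u v; rewrite lr bmul_linearr.
by move=> Y; rewrite /r !(bcomp_cl, bmul_cl); apply/bcl_iso/biso_res_prod.
Qed.

Lemma burnside_frob (G H : finGroupType) (phi : {multiplicative G -> H})
    (a : Bk k H triv) (b : Bk k G triv) :
  bmul a (bcomp (bcl k (bInd phi)) b) =
  bcomp (bcl k (bInd phi)) (bmul (bcomp (bcl k (bRes phi)) a) b).
Proof.
pose r := bcomp (G := triv) (bcl k (bRes phi)).
pose i := bcomp (G := triv) (bcl k (bInd phi)).
have lr : linear r by apply: bcomp_linearr.
have li : linear i by apply: bcomp_linearr.
apply: (@blin_ext _ _ _ _ (fun a => bmul a (i b)) (fun a => i (bmul (r a) b))).
- exact: bmul_linearl.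
- by move=> c u v; rewrite lr bmul_linearl li.
move=> X; apply: (@blin_ext _ _ _ _ (fun b => bmul (bcl k X) (i b))
                                    (fun b => i (bmul (r (bcl k X)) b))).
- by move=> c u v; rewrite li bmul_linearr.
- by move=> c u v; rewrite bmul_linearr li.
by move=> Y; rewrite /i /r !(bcomp_cl, bmul_cl); apply/bcl_iso/biso_frob.
Qed.

Definition burnside : green k D.
Proof.
refine (@Green k D (fun G => burnside_ring k G triv) burnside_fun _ _ _ _).
- by move=> G H phi a b; apply: burnside_res_mul.
- by move=> G H phi; rewrite /= /bone bcomp_cl; apply/bcl_iso/biso_res_point.
- by move=> G H phi a b; apply: burnside_frob.
- by move=> G H phi a b; rewrite /= ![bmul _ a]bmulC burnside_frob [in RHS]bmulC.
Defined.
End BurnsideFunctor.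

Section SubBiset.
Variables (H G : finGroupType) (X : biset H G) (P : pred X).
Hypothesis Pl : forall h x, P x -> P (lact h x).
Hypothesis Pr : forall x g, P x -> P (ract x g).

Definition bsub_on : biset_on H G {x | P x}.
Proof.
refine (@BisetOn H G {x | P x}
  (fun h u => Sub (lact h (val u)) (Pl h (valP u)))
  (fun u g => Sub (ract (val u) g) (Pr g (valP u))) _ _ _ _ _).
- by move=> u; apply: val_inj; rewrite SubK lact1.
- by move=> h h' u; apply: val_inj; rewrite !SubK lactM.
- by move=> u; apply: val_inj; rewrite SubK ract1.
- by move=> u g g'; apply: val_inj; rewrite !SubK ractM.
- by move=> h u g; apply: val_inj; rewrite !SubK lractA.
Defined.
Definition bsub : biset H G := Biset bsub_on.
End SubBiset.

Lemma biso_split (H G : finGroupType) (X : biset H G) (P : pred X)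
  (Pl : forall h x, P x -> P (lact h x)) (Pr : forall x g, P x -> P (ract x g))
  (Nl : forall h x, ~~ P x -> ~~ P (lact h x))
  (Nr : forall x g, ~~ P x -> ~~ P (ract x g)) :
  biso X (bsum (bsub Pl Pr) (bsub (P := fun x => ~~ P x) Nl Nr)).
Proof.
apply: biso_sym.
pose F (u : bsum (bsub Pl Pr) (bsub (P := fun x => ~~ P x) Nl Nr)) : X :=
  match u with inl x => val x | inr x => val x end.
exists F; split; [|by move=> h []|by case].
have Fs x : exists u, F u == x.
  case Px: (P x); first by exists (inl (Sub x Px)).
  by have nPx := negbT Px; exists (inr (exist _ x nPx)).
exists (fun x => xchoose (Fs x)) => [u|x]; last exact/eqP/(xchooseP (Fs x)).
move: (xchoose _) (eqP (xchooseP (Fs (F u)))).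
case: u => [[y py]|[y py]] [[x px]|[x px]] /= e.
- by congr inl; apply: val_inj.
- by case/negP: px; rewrite e.
- by case/negP: py; rewrite -e.
- by congr inr; apply: val_inj.
Qed.

Section Orbit.
Variables (G : finGroupType) (X : biset G triv) (x0 : X).

Lemma ract_triv (x : X) g : ract x g = x.
Proof. by rewrite (_ : g = 1%g) ?ract1 //; apply/val_inj; case: g => [[]]. Qed.

Definition stab_set : {set G} := [set g | lact g x0 == x0].
Lemma stab_group_set : group_set stab_set.
Proof.
apply/group_setP; split=> [|g h]; rewrite !inE ?lact1 //.
by move=> /eqP a /eqP b; rewrite lactM b a.
Qed.
Definition stab : {group G} := Group stab_group_set.

Definition orb : pred X := fun x => [exists g, lact g x0 == x].
Lemma orb_l h x : orb x -> orb (lact h x).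
Proof.
by case/existsP => g /eqP <-; apply/existsP; exists (h * g)%g; rewrite lactM.
Qed.
Lemma orb_r x g : orb x -> orb (ract x g).
Proof. by rewrite ract_triv. Qed.
Lemma norb_l h x : ~~ orb x -> ~~ orb (lact h x).
Proof. by apply: contra => /(orb_l h^-1%g); rewrite lactK. Qed.
Lemma norb_r x g : ~~ orb x -> ~~ orb (ract x g).
Proof. by rewrite ract_triv. Qed.

Lemma sgvalMul : {morph (sgval : subg_of stab -> G) : x y / (x * y)%g}.
Proof. by []. Qed.
HB.instance Definition _ :=
  isMultiplicative.Build (subg_of stab) G (@sgval G stab) sgvalMul.

Definition stab_incl : {multiplicative (subg_of stab) -> G} := @sgval G stab.

Lemma biso_orb : biso (tens (bInd stab_incl) (bpoint (subg_of stab) triv))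
                      (bsub orb_l orb_r).
Proof.
have orb0 g : orb (lact g x0) by apply/existsP; exists g.
apply: (@biso_tens _ _ _ (bInd stab_incl) (bpoint _ triv) (bsub orb_l orb_r)
  (fun (g : G) _ => exist _ (lact g x0) (orb0 g))).
- move=> g s u; apply: val_inj => /=.
  have := valP s; rewrite inE => /eqP e.
  by apply: etrans (lactM g (sgval s) x0) _; rewrite e.
- move=> g u g' u' [e]; apply/tpairP.
  have S : (g^-1 * g')%g \in stab by rewrite inE lactM -e lactK.
  exists (subg stab (g^-1 * g')%g); last by case: u u' => [] [].
  by rewrite /ract /= subgK // mulKVg.
- case=> x ox; have /existsP[g /eqP e] := ox.
  by exists g, tt; apply: val_inj.
- by move=> a g u; apply: val_inj; rewrite /= -lactM.
- by move=> g u a; apply: val_inj; rewrite /= ract_triv.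
Qed.
End Orbit.

Section Initial.
Variables (k : comPzRingType) (D : group_class) (A : green k D).

Definition bunit (G : dobj D) (x : burnside k D G) : A G :=
  gmap (G := dobj_triv) x (kone (A dobj_triv)).

Lemma lin0 (M N : lmodType k) (f : M -> N) : linear f -> f 0 = 0.
Proof. by move=> l; have := l (-1) 0 0; rewrite scaler0 addr0 scaleN1r addNr. Qed.
Lemma linD (M N : lmodType k) (f : M -> N) : linear f -> {morph f : x y / x + y}.
Proof. by move=> l x y; have := l 1 x y; rewrite !scale1r. Qed.

Lemma bunit_linear G : linear (@bunit G).
Proof. by move=> a x y; apply: gmap_linear_biset. Qed.

Lemma bunit_nat (G H : dobj D) (x : Bk k H G) (a : burnside k D G) :
  bunit (gmap (A := burnside k D) x a) = gmap x (bunit a).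
Proof. exact: gmap_comp. Qed.

Lemma bunit_one (G : dobj D) : bunit (kone (burnside k D G)) = kone (A G).
Proof.
pose c (g : G) : triv := 1%g.
have cM : {morph c : x y / (x * y)%g} by move=> x y; rewrite mulg1.
pose phi : {multiplicative G -> triv} :=
  HB.pack c (isMultiplicative.Build G triv c cM).
rewrite -(gmap_res_one A (H := dobj_triv) phi) /bunit; congr (gmap _ _).
apply: bcl_iso; exists (fun _ => ord0); split => //.
- by exists (fun _ => tt) => [[]|x] //; apply/val_inj; case: x => [[]].
- by move=> g u; apply/val_inj; case: (lact _ _) => [[]].
- by move=> u g; apply/val_inj; case: (ract _ _) => [[]].
Qed.

Lemma class_subg (G : dobj D) (K : {group G}) : D (subg_of K).
Proof.
apply: (class_subquo (normal1 K)); last exact: dgrpP G.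
exact: isog_trans (isog_symr (isog_subg K)) (quotient1_isog K).
Qed.

Let mulP (G : dobj D) (x : burnside k D G) : Prop :=
  forall y, bunit (kmul x y) = kmul (bunit x) (bunit y).

Lemma mulP_ind (K G : dobj D) (phi : {multiplicative K -> G}) :
  mulP (bcl k (tens (bInd phi) (bpoint K triv))).
Proof.
move=> y; rewrite -bcomp_cl.
rewrite -[X in kmul X y]/(gmap (A := burnside k D) (bcl k (bInd phi)) (kone (burnside k D K))).
by rewrite gmap_frobr kmul1l !bunit_nat gmap_frobr bunit_one kmul1l.
Qed.

Lemma bunit_mul (G : dobj D) (x y : burnside k D G) :
  bunit (kmul x y) = kmul (bunit x) (bunit y).
Proof.
have mulD u v : mulP u -> mulP v -> mulP (u + v).
  move=> hu hv z; rewrite (linD (@bunit_linear _)).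
  by rewrite !(linD (kmul_linearl _)) (linD (@bunit_linear _)) hu hv.
have mul0 : mulP (0 : burnside k D G).
  move=> z; rewrite (lin0 (@bunit_linear _)).
  by rewrite !(lin0 (kmul_linearl _)) (lin0 (@bunit_linear _)).
suff mulX n (X : biset G triv) : (#|X| <= n)%N -> mulP (bcl k X).
  apply: (@blin_ext _ _ _ _ (fun x : burnside k D G => bunit (kmul x y))
                    (fun x : burnside k D G => kmul (bunit x) (bunit y))) => [||X].
  - by move=> a u v; rewrite kmul_linearl bunit_linear.
  - by move=> a u v; rewrite bunit_linear kmul_linearl.
  - exact: mulX (leqnn _) y.
elim: n X => [|n IHn] X.
  rewrite leqn0 => /eqP X0; suff -> : bcl k X = 0 by [].
  apply: (addrI (bcl k X)); rewrite addr0 -(@bcl_add _ _ _ X) //.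
  have noX (z : X) : False by have := card0_eq X0 z.
  exists (fun z => inl z); split => [|h z|z]; try by case: (noX z).
  by exists (fun u => match u with inl z => z | inr z => z end) => [//|[] z]; case: (noX z).
case: (pickP X) => [x0 _ leX|X0 _]; last by apply: IHn; rewrite (eq_card0 X0).
rewrite (bcl_add _ (biso_split (@orb_l _ _ x0) (@orb_r _ _ x0) (@norb_l _ _ x0) (@norb_r _ _ x0))).
apply: mulD.
  rewrite -(bcl_iso _ (biso_orb x0)).
  exact: (@mulP_ind (DObj (class_subg (stab x0))) G (stab_incl x0)).
apply: IHn; rewrite card_sig -ltnS; apply: leq_trans leX.
rewrite [X in (_ < X)%N](cardD1 x0) inE add1n ltnS; apply/subset_leq_card/subsetP => z.
rewrite !inE andbT; apply: contra => /eqP ->.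
by apply/existsP; exists 1%g; rewrite lact1.
Qed.

(* The unique morphism from the Burnside functor to A, see burnside_mor_unique. *)
Definition burnside_mor : green_mor (burnside k D) A :=
  GreenMor (@bunit_linear) (@bunit_nat) (@bunit_mul) bunit_one.

Lemma burnside_mor_unique (e : green_mor (burnside k D) A) (G : dobj D)
    (x : burnside k D G) : e G x = burnside_mor G x.
Proof.
have {1}-> : x = gmap (A := burnside k D) (G := dobj_triv) x (kone (burnside k D dobj_triv)).
  rewrite -[LHS]bcomp1r; congr bcomp; apply: bcl_iso.
  exists (fun _ => tt); split => //.
  by exists (fun _ => 1%g) => [x0|[]] //; apply/val_inj; case: x0 => [[]].
by rewrite gmor_nat gmor_one.
Qed.
End Initial.

Section AssociatedCategory.
Variables (k : comPzRingType) (D : group_class) (A : green k D).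

Definition PA_hom (G H : dobj D) : Type := A (dobj_prod H G).
HB.instance Definition _ G H := GRing.Lmodule.on (PA_hom G H).

Definition gcross (G H : dobj D) (a : A G) (b : A H) : A (dobj_prod G H) :=
  kmul (gmap (H := dobj_prod G H) (bcl k (bRes (fst : {multiplicative G * H -> G}))) a)
       (gmap (H := dobj_prod G H) (bcl k (bRes (snd : {multiplicative G * H -> H}))) b).

Definition PA_comp (G H K : dobj D) (alpha : PA_hom H K) (beta : PA_hom G H) : PA_hom G K :=
  gmap (G := dobj_prod (dobj_prod K H) (dobj_prod H G)) (H := dobj_prod K G)
       (bcl k (bmid K H G)) (gcross alpha beta).

Definition PA_id (G : dobj D) : PA_hom G G :=
  gmap (G := dobj_triv) (H := dobj_prod G G) (bcl k (bset_arrow (breg G))) (kone (A dobj_triv)).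

Definition PA_inverse (G H : dobj D) (alpha : PA_hom G H) (beta : PA_hom H G) : Prop :=
  PA_comp beta alpha = PA_id G /\ PA_comp alpha beta = PA_id H.

Definition PA_aut (G : dobj D) (alpha : PA_hom G G) : Prop :=
  exists beta, PA_inverse alpha beta.

Definition PA_tilde (G : dobj D) (a : A G) : PA_hom G G :=
  gmap (H := dobj_prod G G) (bcl k (bInd (@gdiag G))) a.

Definition PA_dInf (G : dobj D) (N : {group G}) (nN : (N <| [set: G])%g)
    (alpha : PA_hom (dobj_quo G nN) (dobj_quo G nN)) : PA_hom G G :=
  PA_id G +
  PA_comp (burnside_mor A (dobj_prod G (dobj_quo G nN)) (barrow (bcl k (bInf nN))) : PA_hom (dobj_quo G nN) G)
    (PA_comp (alpha - PA_id (dobj_quo G nN))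
       (burnside_mor A (dobj_prod (dobj_quo G nN) G) (barrow (bcl k (bDef nN))) : PA_hom G (dobj_quo G nN))).
End AssociatedCategory.

Definition PA_map (k : comPzRingType) (D : group_class) (A C : green k D)
    (f : green_mor A C) (G H : dobj D) (alpha : PA_hom A G H) : PA_hom C G H :=
  f (dobj_prod H G) alpha.

Section Star.
Variables (k : comPzRingType) (D : group_class) (A : star_green k D).

(* Iso of the exchange isomorphism is its Ind. *)
Definition PA_dual (G H : dobj D) (alpha : PA_hom A G H) : PA_hom A H G :=
  gmap (G := dobj_prod H G) (H := dobj_prod G H) (bcl k (bInd (@gswap H G))) (star alpha).

Definition PA_orth_aut (G : dobj D) (omega : PA_hom A G G) : Prop :=
  exists2 omega', PA_inverse omega omega' & PA_dual omega = omega'.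

Definition orthogonal_unit (G : dobj D) (u : A G) : Prop :=
  exists2 v, kmul u v = kone (A G) /\ kmul v u = kone (A G) & star u = v.
End Star.

(* Main.v *)
(* The category P_A is a category of correspondences: since K x H x G is the biset
   Ind(p13) o Res(p12, p23), the composition is a o b = p13_*(p12^* a . p23^* b)
   with lower stars for Ind and upper stars for Res. Together with Frobenius
   reciprocity and base change along pullback squares of groups this yields
   associativity and the formula for composing with Ind(phi, psi)(c), hence
   tilde(a) o tilde(b) = tilde(ab) and Def o Inf = Id; from Def o Inf = Id one gets
   dInf(a) o dInf(b) = dInf(a o b). The duality reverses composition and exchanges
   Inf and Def. A morphism f of star-Green functors commutes with Ind, Res,
   products and stars, hence with everything above. *)
From HB Require Import structures.
From mathcomp Require Import all_boot all_order all_algebra all_fingroup.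
Require Import Defs.

Set Implicit Arguments.
Unset Strict Implicit.
Unset Printing Implicit Defensive.

Import GRing.Theory.

(** * Homomorphisms into a direct product *)

Section HomPair.
Local Open Scope group_scope.
Variables (S G H : finGroupType).
Variables (phi : {multiplicative S -> G}) (psi : {multiplicative S -> H}).

(** Diagonals, graphs and partial projections are all written with this one pairing, so that
    equalities between their composites can be checked pointwise. *)
Definition hpair_fun (s : S) : G * H := (phi s, psi s).
Lemma hpair_funM : {morph hpair_fun : x y / x * y}.
Proof. by move=> x y; rewrite /hpair_fun !gmulfM. Qed.
HB.instance Definition _ := isMultiplicative.Build S (G * H)%type hpair_fun hpair_funM.

Definition hpair : {multiplicative S -> G * H} := hpair_fun.
End HomPair.

(** * Isomorphisms between elementary bisets *)

Section BisetIsos.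
Local Open Scope group_scope.

Lemma mulfV (G H : finGroupType) (phi : {multiplicative G -> H}) x :
  phi x^-1 = (phi x)^-1.
Proof. by apply: (mulgI (phi x)); rewrite -gmulfM !mulgV mulf1. Qed.

Lemma biso_ind_comp (G H L : finGroupType) (phi : {multiplicative G -> H})
    (psi : {multiplicative H -> L}) : biso (tens (bInd psi) (bInd phi)) (bInd (psi \o phi)).
Proof.
apply: (@biso_tens _ _ _ (bInd psi) (bInd phi) (bInd (psi \o phi))
  (fun (l : L) (h : H) => l * psi h)).
- by move=> y h x; rewrite /ract /lact /= gmulfM mulgA.
- move=> y x y' x' /= E; apply/tpairP; exists (x * x'^-1); last by rewrite /lact /= mulgKV.
  by rewrite /ract /= gmulfM mulgA E -mulgA -gmulfM mulgV mulf1 mulg1.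
- by move=> z; exists z, 1; rewrite mulf1 mulg1.
- by move=> a y x; rewrite /lact /= mulgA.
- by move=> y x a; rewrite /ract /= gmulfM mulgA.
Qed.

Lemma biso_res_comp (G H L : finGroupType) (phi : {multiplicative G -> H})
    (psi : {multiplicative H -> L}) : biso (tens (bRes phi) (bRes psi)) (bRes (psi \o phi)).
Proof.
apply: (biso_trans (biso_tens_res _ _)).
by exists id; split=> //; exists id.
Qed.

Lemma biso_ind_res (G H : finGroupType) (phi : {multiplicative G -> H})
    (psi : {multiplicative H -> G}) :
  cancel phi psi -> cancel psi phi -> biso (bInd phi) (bRes psi).
Proof.
move=> phiK psiK; exists (psi : H -> G); split; first by exists phi.
  by move=> h x; apply: gmulfM.
by move=> x g; rewrite /ract /= gmulfM phiK.
Qed.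

(** The isomorphism is multiplication on $H$. If $xy=x'y'$, then $x^{-1}x'$ lifts to $G$ by
    surjectivity, and the lift identifies the two pairs in the tensor product. *)
Lemma biso_ind_res_surj (G H : finGroupType) (phi : {multiplicative G -> H}) :
  (forall h, exists g, phi g = h) -> biso (tens (bInd phi) (bRes phi)) (breg H).
Proof.
move=> surj; apply: (@biso_tens _ _ _ (bInd phi) (bRes phi) (breg H)
  (fun x y : H => x * y)).
- by move=> y h x; rewrite /ract /lact /= mulgA.
- move=> y x y' x' E; apply/tpairP; have [g eg] := surj (y^-1 * y').
  exists g; rewrite /ract /lact /= eg ?mulKVg //.
  by rewrite -mulgA -E mulKg.
- by move=> z; exists z, 1; rewrite mulg1.
- by move=> a y x; rewrite /lact /= mulgA.
- by move=> y x a; rewrite /ract /= mulgA.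
Qed.

(* Both sides are K with h.z.g = psi(h) z phi(g); the Mackey formula has a single
   term because psi(H) phi(G) = K. *)
Lemma biso_pullback (G H K P : finGroupType)
    (phi : {multiplicative G -> K}) (psi : {multiplicative H -> K})
    (p : {multiplicative P -> G}) (q : {multiplicative P -> H}) :
  (forall x, phi (p x) = psi (q x)) ->
  (forall g h, phi g = psi h -> exists2 x, p x = g & q x = h) ->
  (forall z, exists h g, psi h * phi g = z) ->
  biso (tens (bRes psi) (bInd phi)) (tens (bInd q) (bRes p)).
Proof.
move=> comm cart full; apply: (biso_trans (biso_tens_res _ _)); apply: biso_sym.
apply: (@biso_tens _ _ _ (bInd q) (bRes p) (brestr psi (bInd phi))
  (fun (h : H) (g : G) => psi h * phi g)) => //.
- by move=> h x g; rewrite /ract /lact /= !gmulfM comm mulgA.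
- move=> h g h' g' /= E; apply/tpairP.
  have [|x ep eq] := cart (g * g'^-1) (h^-1 * h').
    by apply: (mulgI (psi h)); rewrite !gmulfM !mulfV mulKVg mulgA E mulgK.
  by exists x; rewrite /ract /lact /= ?eq ?ep ?mulKVg ?mulgKV.
- by move=> a h g; rewrite /lact /= /lact /= gmulfM mulgA.
- by move=> h g a; rewrite /ract /= /ract /= gmulfM mulgA.
Qed.

(** The middle group $H$ acts diagonally on the pair $(h_1,h_2)$, whose only invariant is
    $h_1^{-1}h_2$; the outer coordinates are multiplied together. *)
Lemma biso_mid (K H G : finGroupType) :
  biso (tens (bInd (hpair (fst \o fst) snd : {multiplicative K * H * G -> K * G}))
             (bRes (hpair fst (hpair (snd \o fst) snd)
                    : {multiplicative K * H * G -> (K * H) * (H * G)})))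
       (bmid K H G).
Proof.
apply: (@biso_tens _ _ _ (bInd _) (bRes _) (bmid K H G)
  (fun (y : K * G) (x : (K * H) * (H * G)) =>
     (y.1 * x.1.1, x.1.2^-1 * x.2.1, y.2 * x.2.2))).
- by move=> [k g] [[a h] b] [[k1 h1] [h2 g1]]; rewrite /ract /lact /= invMg !mulgA mulgKV.
- move=> [k g] [[k1 h1] [h2 g1]] [k' g'] [[k1' h1'] [h2' g1']] /= [ek eh eg].
  (* The outer entries are forced by the left factors of the two tensors; the middle entry must
     carry [h1'] to [h1]. *)
  apply/tpairP; exists (k^-1 * k', h1 * h1'^-1, g^-1 * g').
    by rewrite /ract /=; congr (_, _); rewrite /= mulKVg.
  congr (_, _, (_, _)) => /=.
  + by rewrite -mulgA -ek mulKg.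
  + by rewrite mulgKV.
  + by rewrite -mulgA -eh mulKVg.
  + by rewrite -mulgA -eg mulKg.
- by move=> [[k h] g]; exists (k, g), ((1, 1), (h, 1)); rewrite /= !mulg1 invg1 mul1g.
- by move=> [a b] [k g] x; rewrite /lact /=; congr (_, _, _); rewrite /= mulgA.
- by move=> [k g] x [[a b] [c d]]; rewrite /ract /= invMg !mulgA.
Qed.

(** A transitive $T$-set in which some point has stabiliser $\rho(S)$ is the coset space
    $T/\rho(S)$, which is Ind of the one-point $S$-set. *)
Lemma biso_coset (T S : finGroupType) (rho : {multiplicative S -> T})
    (X : biset T triv) (x0 : X) :
  (forall t, lact t x0 = x0 <-> exists s, rho s = t) ->
  (forall x, exists t, lact t x0 = x) ->
  biso (tens (bInd rho) (bpoint S triv)) X.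
Proof.
move=> stab trans; apply: (@biso_tens _ _ _ (bInd rho) (bpoint S triv) X
  (fun (t : T) _ => lact t x0)).
- move=> t s u; rewrite /ract /=.
  have /stab e : exists s', rho s' = rho s by exists s.
  by apply: etrans (lactM t (rho s) x0) _; rewrite e.
- move=> t u t' u' /= E; apply/tpairP.
  have /stab[s es] : lact (t^-1 * t') x0 = x0 by rewrite lactM -E lactK.
  by exists s; [rewrite /ract /= es mulKVg | case: u u' => [] []].
- by move=> x; have [t <-] := trans x; exists t, tt.
- by move=> a t u; rewrite -lactM.
- by move=> t u a; rewrite ract_triv.
Qed.

(** The action $(g,h)\cdot x=\phi(g)xh^{-1}$ is transitive, and the stabiliser of $1$ is the graph
    of [phi]. *)
Lemma biso_arrow_res (G H : finGroupType) (phi : {multiplicative G -> H}) :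
  biso (tens (bInd (hpair idfun phi)) (bpoint G triv)) (bset_arrow (bRes phi)).
Proof.
apply: (@biso_coset (G * H)%type G (hpair idfun phi) (bset_arrow (bRes phi)) (1 : H)).
  move=> [g h]; rewrite /lact /= /lact /ract /= mulg1; split=> [/(canRL (mulgKV _))|[s [<- <-]]].
    by rewrite mul1g => <-; exists g.
  by rewrite mulgV.
by move=> x; exists (1, x^-1); rewrite /lact /= /lact /ract /= mulf1 !mul1g invgK.
Qed.

Lemma biso_arrow_ind (G H : finGroupType) (phi : {multiplicative G -> H}) :
  biso (tens (bInd (hpair phi idfun)) (bpoint G triv)) (bset_arrow (bInd phi)).
Proof.
apply: (@biso_coset (H * G)%type G (hpair phi idfun) (bset_arrow (bInd phi)) (1 : H)).
  move=> [h g]; rewrite /lact /= /lact /ract /= mulg1; split=> [|[s [<- <-]]].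
    by rewrite mulfV => /(canRL (mulgKV _)); rewrite mul1g => ->; exists g.
  by rewrite mulfV mulgV.
by move=> x; exists (x, 1); rewrite /lact /= /lact /ract /= invg1 mulf1 !mulg1.
Qed.
End BisetIsos.

Lemma linB (k : pzRingType) (M P : lmodType k) (f : M -> P) : linear f -> {morph f : x y / (x - y)%R}.
Proof. by move=> l x y; rewrite addrC -scaleN1r l scaleN1r addrC. Qed.

(** Triple products are bracketed to the left, so the projection to $K\times H$ is just [fst]. *)
Definition pr13 (K H G : finGroupType) : {multiplicative K * H * G -> K * G} :=
  hpair (fst \o fst) snd.
Definition pr23 (K H G : finGroupType) : {multiplicative K * H * G -> H * G} :=
  hpair (snd \o fst) snd.

(** * Calculus of Ind and Res, and composition in the associated category *)

Section IndRes.
Variables (k : comPzRingType) (D : group_class) (A : green k D).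

Definition gind (G H : dobj D) (phi : {multiplicative G -> H}) : A G -> A H :=
  gmap (bcl k (bInd phi)).
Definition gres (G H : dobj D) (phi : {multiplicative G -> H}) : A H -> A G :=
  gmap (bcl k (bRes phi)).

Lemma gresM (G H : dobj D) (phi : {multiplicative G -> H}) (a b : A H) :
  gres phi (kmul a b) = kmul (gres phi a) (gres phi b).
Proof. exact: gmap_res_mul. Qed.

Lemma kmul_gindr (G H : dobj D) (phi : {multiplicative G -> H}) (a : A H) b :
  kmul a (gind phi b) = gind phi (kmul (gres phi a) b).
Proof. exact: gmap_frobl. Qed.

Lemma kmul_gindl (G H : dobj D) (phi : {multiplicative G -> H}) (a : A H) b :
  kmul (gind phi b) a = gind phi (kmul b (gres phi a)).
Proof. exact: gmap_frobr. Qed.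

Lemma gind_comp (G H L : dobj D) (phi : {multiplicative G -> H})
    (psi : {multiplicative H -> L}) a : gind psi (gind phi a) = gind (psi \o phi) a.
Proof.
by rewrite /gind -gmap_comp bcomp_cl (bcl_iso _ (biso_ind_comp phi psi)).
Qed.

Lemma gres_comp (G H L : dobj D) (phi : {multiplicative G -> H})
    (psi : {multiplicative H -> L}) a : gres phi (gres psi a) = gres (psi \o phi) a.
Proof.
by rewrite /gres -gmap_comp bcomp_cl (bcl_iso _ (biso_res_comp phi psi)).
Qed.

(** Composites of bundled homomorphisms need not agree as terms; pointwise agreement is enough,
    because the identity map is then an isomorphism of bisets. *)
Lemma gind_ext (G H : dobj D) (phi psi : {multiplicative G -> H}) a b :
  phi =1 psi -> a = b -> gind phi a = gind psi b.
Proof.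
move=> e ->; congr (gmap _ b); apply: bcl_iso.
by exists id; split=> // [|x g]; [exists id | rewrite /ract /= e].
Qed.

Lemma gres_ext (G H : dobj D) (phi psi : {multiplicative G -> H}) a :
  phi =1 psi -> gres phi a = gres psi a.
Proof.
move=> e; congr (gmap _ a); apply: bcl_iso.
by exists id; split=> // [|g x]; [exists id | rewrite /lact /= e].
Qed.

Lemma gind_id (G : dobj D) a : gind (idfun : {multiplicative G -> G}) a = a.
Proof. by rewrite -[RHS]gmap_id; congr (gmap _ a); apply: bcl_iso; exists id; split=> //; exists id. Qed.

Lemma gres_id (G : dobj D) a : gres (idfun : {multiplicative G -> G}) a = a.
Proof. by rewrite -[RHS]gmap_id; congr (gmap _ a); apply: bcl_iso; exists id; split=> //; exists id. Qed.

Lemma gind_can (G H : dobj D) (phi : {multiplicative G -> H})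
    (psi : {multiplicative H -> G}) a :
  cancel phi psi -> cancel psi phi -> gind phi a = gres psi a.
Proof. by move=> h1 h2; rewrite /gind (bcl_iso _ (biso_ind_res h1 h2)). Qed.

(** Base change: [P] maps onto the pullback of [phi] and [psi], and the Mackey sum has one term
    because $\psi(H)\phi(G)=K$. *)
Lemma gres_gind (G H K P : dobj D)
    (phi : {multiplicative G -> K}) (psi : {multiplicative H -> K})
    (p : {multiplicative P -> G}) (q : {multiplicative P -> H}) a :
  (forall x, phi (p x) = psi (q x)) ->
  (forall g h, phi g = psi h -> exists2 x, p x = g & q x = h) ->
  (forall z, exists h g, psi h * phi g = z)%g ->
  gres psi (gind phi a) = gind q (gres p a).
Proof.
move=> comm cart full; rewrite /gres /gind -!gmap_comp !bcomp_cl.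
by rewrite (bcl_iso _ (biso_pullback comm cart full)).
Qed.

(** The one-point $S$-set sends $\epsilon_A$ to the unit of $A(S)$, so the class of $T/\rho(S)$
    sends it to Ind of that unit. *)
Lemma gmap_coset (S T : dobj D) (rho : {multiplicative S -> T}) (X : biset T triv) :
  biso (tens (bInd rho) (bpoint S triv)) X ->
  gmap (G := dobj_triv) (bcl k X) (kone (A dobj_triv)) = gind rho (kone (A S)).
Proof.
move=> i; rewrite -(bcl_iso _ i) -bcomp_cl (@gmap_comp _ _ _ dobj_triv S T).
by congr (gmap _ _); apply: bunit_one.
Qed.

(** Res is multiplicative, so it passes inside the cross product and merges with the two inflations
    there. *)
Lemma PA_compE (K H G : dobj D) (alpha : PA_hom A H K) (beta : PA_hom A G H) :
  PA_comp alpha beta =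
  gind (G := dobj_prod (dobj_prod K H) G) (H := dobj_prod K G) (pr13 K H G)
    (kmul (gres (G := dobj_prod (dobj_prod K H) G) (H := dobj_prod K H) fst alpha)
          (gres (G := dobj_prod (dobj_prod K H) G) (H := dobj_prod H G) (pr23 K H G) beta)).
Proof.
rewrite /PA_comp -(bcl_iso _ (biso_mid K H G)) -bcomp_cl.
rewrite (@gmap_comp _ _ _ _ (dobj_prod (dobj_prod K H) G)) /gcross gmap_res_mul.
congr (gmap _ (kmul _ _)); by rewrite -/(gres _ _) gres_comp; apply: gres_ext.
Qed.

Lemma PA_comp_linearl (K H G : dobj D) (beta : PA_hom A G H) :
  linear (fun alpha : PA_hom A H K => PA_comp alpha beta).
Proof.
by move=> c u v; rewrite !PA_compE /gres /gind gmap_linear kmul_linearl gmap_linear.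
Qed.

Lemma PA_comp_linearr (K H G : dobj D) (alpha : PA_hom A H K) :
  linear (fun beta : PA_hom A G H => PA_comp alpha beta).
Proof.
by move=> c u v; rewrite !PA_compE /gres /gind gmap_linear kmul_linearr gmap_linear.
Qed.

(** Both sides become Ind from $L\times K\times H\times G$ to $L\times G$ of the product of the
    three pulled-back factors. *)
Lemma PA_compA (L K H G : dobj D) (alpha : PA_hom A K L) (beta : PA_hom A H K)
    (gamma : PA_hom A G H) :
  PA_comp alpha (PA_comp beta gamma) = PA_comp (PA_comp alpha beta) gamma.
Proof.
pose P := dobj_prod (dobj_prod (dobj_prod L K) H) G.
rewrite !PA_compE.
(* [P] is the pullback of $K\times H\times G$ and $L\times K\times G$ over $K\times G$. *)
rewrite (@gres_gind (dobj_prod (dobj_prod K H) G) (dobj_prod (dobj_prod L K) G)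
  (dobj_prod K G) P (pr13 K H G) (pr23 L K G)
  (hpair (pr23 L K H \o fst) snd) (hpair (fst \o fst) snd)) //; first last.
- by move=> [x g]; exists (1, x, g)%g, 1%g; rewrite mulf1 mulg1.
- move=> [[x h] g] [[l x'] g'] [-> ->].
  by exists (l, x', h, g').
(* [P] is also the pullback of $L\times K\times H$ and $L\times H\times G$ over $L\times H$. *)
rewrite (@gres_gind (dobj_prod (dobj_prod L K) H) (dobj_prod (dobj_prod L H) G)
  (dobj_prod L H) P (pr13 L K H)
  fst fst (hpair (pr13 L K H \o fst) snd)) //; first last.
- by move=> z; exists (z, 1)%g, 1%g; rewrite mulf1 mulg1.
- by move=> x [z g] /= <-; exists (x, g).
rewrite kmul_gindr kmul_gindl !gresM kmulA !gind_comp !gres_comp.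
apply: gind_ext => [[[[l x] h] g]|]; first by [].
by apply: (f_equal2 (@kmul _ _)); first apply: (f_equal2 (@kmul _ _));
  apply: gres_ext => -[[[l x] h] g].
Qed.

(** The pullback of [hpair phi psi] along $K\times H\times G\to K\times H$ is $S\times G$, so
    Frobenius reciprocity moves the whole product there. *)
Lemma PA_comp_indl (S K H G : dobj D) (phi : {multiplicative S -> K})
    (psi : {multiplicative S -> H}) (c : A S) (beta : PA_hom A G H) :
  PA_comp (gind (H := dobj_prod K H) (hpair phi psi) c : PA_hom A H K) beta =
  gind (G := dobj_prod S G) (H := dobj_prod K G) (hpair (phi \o fst) snd)
    (kmul (gres (G := dobj_prod S G) fst c)
          (gres (G := dobj_prod S G) (H := dobj_prod H G) (hpair (psi \o fst) snd) beta)).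
Proof.
rewrite PA_compE (@gres_gind S (dobj_prod (dobj_prod K H) G) (dobj_prod K H)
  (dobj_prod S G) (hpair phi psi)
  fst fst (hpair (hpair phi psi \o fst) snd)) //; first last.
- by move=> z; exists (z, 1)%g, 1%g; rewrite mulf1 mulg1.
- by move=> x [z g] /= <-; exists (x, g).
rewrite kmul_gindl gind_comp gres_comp; apply: gind_ext => [[s g]|]; first by [].
by congr (kmul _ _); apply: gres_ext => -[s g].
Qed.

Lemma PA_tildeE (G : dobj D) (a : A G) :
  PA_tilde a = gind (H := dobj_prod G G) (hpair idfun idfun) a.
Proof. exact: gind_ext. Qed.

(** The regular biset is Res of the identity, and the graph of the identity is the diagonal. *)
Lemma PA_idE (G : dobj D) : PA_id A G = PA_tilde (kone (A G)).
Proof.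
rewrite PA_tildeE; apply: gmap_coset; apply: biso_trans (biso_arrow_res idfun) _.
by exists id; split=> //; exists id.
Qed.

(** For the diagonal of $H$ in [PA_comp_indl], the maps left on $H\times G$ are pointwise the
    identity. *)
Lemma PA_comp_tildel (G H : dobj D) (a : A H) (beta : PA_hom A G H) :
  PA_comp (PA_tilde a) beta = kmul (gres (G := dobj_prod H G) fst a) beta.
Proof.
rewrite PA_tildeE PA_comp_indl -[RHS](@gind_id (dobj_prod H G)).
apply: gind_ext => [[h g]|]; first by [].
apply: (f_equal2 (@kmul _ _)); first by [].
by rewrite -[RHS](@gres_id (dobj_prod H G)); apply: gres_ext => -[h g].
Qed.

Lemma PA_tildeM (G : dobj D) (a b : A G) :
  PA_comp (PA_tilde a) (PA_tilde b) = PA_tilde (kmul a b).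
Proof.
rewrite PA_comp_tildel !PA_tildeE kmul_gindr; apply: gind_ext => [g|]; first by [].
by rewrite gres_comp -[in RHS](gres_id a); apply: (f_equal2 (@kmul _ _)); first apply: gres_ext.
Qed.

Lemma PA_comp1l (G H : dobj D) (beta : PA_hom A G H) : PA_comp (PA_id A H) beta = beta.
Proof. by rewrite PA_idE PA_comp_tildel /gres gmap_res_one kmul1l. Qed.

Lemma burnside_mor_res (G H : dobj D) (phi : {multiplicative G -> H}) :
  burnside_mor A (dobj_prod G H) (barrow (bcl k (bRes phi))) =
  gind (H := dobj_prod G H) (hpair idfun phi) (kone (A G)).
Proof. by rewrite barrow_cl; exact: (@gmap_coset G (dobj_prod G H) _ _ (biso_arrow_res phi)). Qed.

Lemma burnside_mor_ind (G H : dobj D) (phi : {multiplicative G -> H}) :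
  burnside_mor A (dobj_prod H G) (barrow (bcl k (bInd phi))) =
  gind (H := dobj_prod H G) (hpair phi idfun) (kone (A G)).
Proof. by rewrite barrow_cl; exact: (@gmap_coset G (dobj_prod H G) _ _ (biso_arrow_ind phi)). Qed.

(** The unit of $A(G)$ is restricted from $H$, and Ind after Res is the identity for surjective
    [phi]. *)
Lemma gind_one_surj (G H : dobj D) (phi : {multiplicative G -> H}) :
  (forall h, exists g, phi g = h) -> gind phi (kone (A G)) = kone (A H).
Proof.
move=> s; rewrite /gind -(gmap_res_one A phi) -gmap_comp bcomp_cl.
by rewrite (bcl_iso _ (biso_ind_res_surj s)) gmap_id.
Qed.

(** Both sides are Ind of the unit of $A(G)$ along $g\mapsto(\phi(g),\phi(g))$; for the identity
    this uses that the unit of $A(H)$ is itself induced from $G$. *)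
Lemma PA_comp_def_inf (G H : dobj D) (phi : {multiplicative G -> H}) :
  (forall h, exists g, phi g = h) ->
  PA_comp (burnside_mor A (dobj_prod H G) (barrow (bcl k (bInd phi))) : PA_hom A G H)
          (burnside_mor A (dobj_prod G H) (barrow (bcl k (bRes phi))) : PA_hom A H G) =
  PA_id A H.
Proof.
move=> s; rewrite burnside_mor_res burnside_mor_ind PA_comp_indl PA_idE PA_tildeE.
rewrite -(gind_one_surj s) gind_comp {1}/gres gmap_res_one kmul1l.
(* The remaining Res is along a map that is pointwise the identity; read as an Ind, it composes with
   its neighbours. *)
rewrite -(@gind_can (dobj_prod G H) (dobj_prod G H) (hpair (idfun \o fst) snd)); first last.
- by case.
- by case.
by rewrite !gind_comp; apply: gind_ext.
Qed.

End IndRes.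

(** * The duality and its compatibility with composition *)

Section Duality.
Variables (k : comPzRingType) (D : group_class) (A : star_green k D).
Local Open Scope ring_scope.

(** $1^\star=1^{\star\star}1^\star=(1\cdot 1^\star)^\star=1^{\star\star}=1$. *)
Lemma star_one (G : dobj D) : star (kone (A G)) = kone (A G).
Proof. by rewrite -[LHS]kmul1l -{1}[kone (A G)]starK -starM kmul1l starK. Qed.

Lemma star_gind (G H : dobj D) (phi : {multiplicative G -> H}) (a : A G) :
  star (gind phi a) = gind phi (star a).
Proof. exact: star_nat. Qed.

Lemma star_gres (G H : dobj D) (phi : {multiplicative G -> H}) (a : A H) :
  star (gres phi a) = gres phi (star a).
Proof. exact: star_nat. Qed.

Lemma PA_dualE (G H : dobj D) (alpha : PA_hom A G H) :
  PA_dual alpha = gind (G := dobj_prod H G) (H := dobj_prod G H) (@gswap H G) (star alpha).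
Proof. by []. Qed.

Lemma gind_gres_can (G H : dobj D) (phi : {multiplicative G -> H})
    (psi : {multiplicative H -> G}) (a : A H) :
  cancel phi psi -> cancel psi phi -> gind phi (gres phi a) = a.
Proof.
move=> phiK psiK; rewrite (gind_can _ phiK psiK) gres_comp -[RHS]gres_id.
exact: gres_ext.
Qed.

Lemma PA_dual_linear (G H : dobj D) : linear (@PA_dual _ _ A G H).
Proof. by move=> c u v; rewrite /PA_dual star_linear gmap_linear. Qed.

Lemma PA_dual_ind (S G H : dobj D) (phi : {multiplicative S -> H})
    (psi : {multiplicative S -> G}) (c : A S) :
  PA_dual (gind (H := dobj_prod H G) (hpair phi psi) c : PA_hom A G H) =
  gind (H := dobj_prod G H) (hpair psi phi) (star c).
Proof.
by rewrite PA_dualE star_gind gind_comp; apply: gind_ext.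
Qed.

Lemma PA_dual_tilde (G : dobj D) (a : A G) : PA_dual (PA_tilde a) = PA_tilde (star a).
Proof. by rewrite !PA_tildeE PA_dual_ind. Qed.

Lemma PA_dual_id (G : dobj D) : PA_dual (PA_id A G) = PA_id A G.
Proof. by rewrite PA_idE PA_dual_tilde star_one. Qed.

(** The swap is invertible, so its Ind is a Res. In this form the dual combines directly with the
    pullbacks in [PA_compE]. *)
Lemma PA_dual_res (G H : dobj D) (alpha : PA_hom A G H) :
  PA_dual alpha = gres (G := dobj_prod G H) (H := dobj_prod H G) (@gswap G H) (star alpha).
Proof. by rewrite PA_dualE; apply: gind_can => -[]. Qed.

Lemma PA_dualK (G H : dobj D) (alpha : PA_hom A G H) : PA_dual (PA_dual alpha) = alpha.
Proof.
rewrite PA_dualE PA_dual_res star_gres starK.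
by apply: (@gind_gres_can (dobj_prod G H) (dobj_prod H G) (@gswap G H) (@gswap H G)); case.
Qed.

Lemma PA_dual_comp (G H K : dobj D) (alpha : PA_hom A H K) (beta : PA_hom A G H) :
  PA_dual (PA_comp alpha beta) = PA_comp (PA_dual beta) (PA_dual alpha).
Proof.
(* Reversing the three factors exchanges the projections to the first two and to the last two, just
   as the star reverses the product. *)
pose rev : {multiplicative K * H * G -> G * H * K} :=
  hpair (hpair snd (snd \o fst)) (fst \o fst).
pose rev' : {multiplicative G * H * K -> K * H * G} :=
  hpair (hpair snd (snd \o fst)) (fst \o fst).
rewrite [PA_dual beta]PA_dual_res [PA_dual alpha]PA_dual_res PA_dualE !PA_compE.
rewrite star_gind starM !star_gres !gres_comp gind_comp.
(* Inserting Ind after Res along [rev] moves the right side to $K\times H\times G$, where the left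
   side lives. *)
rewrite -[X in _ = gind _ X](@gind_gres_can (dobj_prod (dobj_prod K H) G)
  (dobj_prod (dobj_prod G H) K) rev rev'); first last.
- by move=> [[g h] x].
- by move=> [[x h] g].
rewrite gind_comp gresM !gres_comp; apply: gind_ext => [[[x h] g]|]; first by [].
by apply: (f_equal2 (@kmul _ _)); apply: gres_ext => -[[x h] g].
Qed.

(* The right unit law is the dual of the left one. *)
Lemma PA_comp1r (G H : dobj D) (alpha : PA_hom A G H) : PA_comp alpha (PA_id A G) = alpha.
Proof. by rewrite -[LHS]PA_dualK PA_dual_comp PA_dual_id PA_comp1l PA_dualK. Qed.

Lemma PA_compDl (G H K : dobj D) (a b : PA_hom A H K) (c : PA_hom A G H) :
  PA_comp (a + b) c = PA_comp a c + PA_comp b c.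
Proof. exact: (linD (PA_comp_linearl c)). Qed.

Lemma PA_compDr (G H K : dobj D) (a : PA_hom A H K) (b c : PA_hom A G H) :
  PA_comp a (b + c) = PA_comp a b + PA_comp a c.
Proof. exact: (linD (PA_comp_linearr a)). Qed.

Lemma PA_compBl (G H K : dobj D) (a b : PA_hom A H K) (c : PA_hom A G H) :
  PA_comp (a - b) c = PA_comp a c - PA_comp b c.
Proof. exact: (linB (PA_comp_linearl c)). Qed.

Lemma PA_compBr (G H K : dobj D) (a : PA_hom A H K) (b c : PA_hom A G H) :
  PA_comp a (b - c) = PA_comp a b - PA_comp a c.
Proof. exact: (linB (PA_comp_linearr a)). Qed.

(** * Inflation of endomorphisms from a quotient *)

Section DInf.
Variables (G : dobj D) (N : {group G}) (nN : (N <| [set: G])%g).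
Let Q : dobj D := dobj_quo G nN.

Let I : PA_hom A Q G := burnside_mor A (dobj_prod G Q) (barrow (bcl k (bInf nN))).
Let J : PA_hom A G Q := burnside_mor A (dobj_prod Q G) (barrow (bcl k (bDef nN))).

Lemma comp_def_inf : PA_comp J I = PA_id A Q.
Proof.
apply: (@PA_comp_def_inf _ _ A G Q) => x; exists (repr x).
exact: coset_reprK.
Qed.

Lemma PA_dInf_id : PA_dInf (PA_id A Q : PA_hom A (dobj_quo G nN) _) = PA_id A G.
Proof.
rewrite /PA_dInf subrr (lin0 (PA_comp_linearl _)) (lin0 (PA_comp_linearr _)).
exact: addr0.
Qed.

(** Since $JI=1$, expanding $(1+I(\alpha-1)J)(1+I(\beta-1)J)$ leaves $1+I\gamma J$ with
    $\gamma=(\alpha-1)+(\beta-1)+(\alpha-1)(\beta-1)=\alpha\beta-1$. *)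
Lemma PA_dInf_comp (alpha beta : PA_hom A Q Q) :
  PA_comp (PA_dInf alpha) (PA_dInf beta) = PA_dInf (PA_comp alpha beta).
Proof.
have comp4 (a b : PA_hom A Q Q) : PA_comp (PA_comp I (PA_comp a J)) (PA_comp I (PA_comp b J)) =
    PA_comp I (PA_comp (PA_comp a b) J).
  by rewrite -!PA_compA [PA_comp J (PA_comp I _)]PA_compA comp_def_inf PA_comp1l.
rewrite /PA_dInf -/I -/J PA_compDl !PA_compDr !PA_comp1l PA_comp1r comp4 -addrA.
rewrite -!PA_compDr -!PA_compDl; congr (_ + PA_comp I (PA_comp _ J)).
by rewrite PA_compBr PA_comp1r PA_compBl PA_comp1l [X in _ + X]addrC subrK addrC addrA subrK.
Qed.

Lemma PA_dual_dInf (alpha : PA_hom A Q Q) :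
  PA_dual (PA_dInf alpha) = PA_dInf (PA_dual alpha).
Proof.
(* Inf and Def are Ind of the unit along the graph of the projection, with opposite orders of the
   coordinates; the swap exchanges them and the star fixes the unit. *)
have IJ : PA_dual I = J.
  rewrite /I /J (@burnside_mor_res _ _ A G Q (qproj nN)) (@burnside_mor_ind _ _ A G Q (qproj nN)).
  by rewrite PA_dual_ind star_one.
have JI : PA_dual J = I by rewrite -IJ PA_dualK.
rewrite /PA_dInf -/I -/J (linD (@PA_dual_linear _ _)) !PA_dual_comp PA_dual_id IJ JI.
rewrite PA_compA; congr (_ + PA_comp (PA_comp I _) J).
by rewrite (linB (@PA_dual_linear _ _)) PA_dual_id.
Qed.
End DInf.
End Duality.

(** * Compatibility of the induced functor with the structure *)

Section Functoriality.
Variables (k : comPzRingType) (D : group_class) (A C : star_green k D).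
Variable f : star_green_mor A C.

Lemma gmor_ind (G H : dobj D) (phi : {multiplicative G -> H}) (a : A G) :
  f H (gind phi a) = gind phi (f G a).
Proof. exact: gmor_nat. Qed.

Lemma PA_map_linear (G H : dobj D) : linear (@PA_map _ _ _ _ f G H).
Proof. exact: gmor_linear. Qed.

Lemma PA_map_dual (G H : dobj D) (alpha : PA_hom A G H) :
  PA_map f (PA_dual alpha) = PA_dual (PA_map f alpha).
Proof. by rewrite /PA_map !PA_dualE gmor_ind smor_star. Qed.

Lemma PA_map_comp (G H K : dobj D) (alpha : PA_hom A H K) (beta : PA_hom A G H) :
  PA_map f (PA_comp alpha beta) = PA_comp (PA_map f alpha) (PA_map f beta).
Proof. by rewrite /PA_map /PA_comp gmor_nat /gcross gmor_mul !gmor_nat. Qed.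

Lemma PA_map_id (G : dobj D) : PA_map f (PA_id A G) = PA_id C G.
Proof. by rewrite /PA_map /PA_id gmor_nat gmor_one. Qed.

Lemma PA_map_tilde (G : dobj D) (a : A G) : PA_map f (PA_tilde a) = PA_tilde (f G a).
Proof. exact: gmor_nat. Qed.

(** [burnside_mor] lets [x] act on $\epsilon_A$; naturality moves [f] past [x], and [f] preserves
    the unit. *)
Lemma PA_map_burnside (G H : dobj D) (x : burnside k D (dobj_prod H G)) :
  PA_map f (burnside_mor A (dobj_prod H G) x : PA_hom A G H) =
  burnside_mor C (dobj_prod H G) x.
Proof. by rewrite /PA_map [LHS]gmor_nat gmor_one. Qed.

Lemma PA_map_inverse (G H : dobj D) (alpha : PA_hom A G H) (beta : PA_hom A H G) :
  PA_inverse alpha beta -> PA_inverse (PA_map f alpha) (PA_map f beta).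
Proof. by case=> e1 e2; split; rewrite -PA_map_comp ?e1 ?e2 PA_map_id. Qed.

Lemma PA_map_orth (G : dobj D) (omega : PA_hom A G G) :
  PA_orth_aut omega -> PA_orth_aut (PA_map f omega).
Proof.
case=> omega' inv e; exists (PA_map f omega'); first exact: PA_map_inverse.
by rewrite -PA_map_dual e.
Qed.

Lemma PA_map_dInf (G : dobj D) (N : {group G}) (nN : (N <| [set: G])%g)
    (alpha : PA_hom A (dobj_quo G nN) (dobj_quo G nN)) :
  PA_map f (PA_dInf alpha) = PA_dInf (PA_map f alpha).
Proof.
rewrite /PA_dInf (linD (@PA_map_linear _ _)) !PA_map_comp PA_map_id !PA_map_burnside.
by rewrite (linB (@PA_map_linear _ _)) PA_map_id.
Qed.

Lemma orthogonal_unit_map (G : dobj D) (u : A G) :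
  orthogonal_unit u -> orthogonal_unit (f G u).
Proof.
case=> v [uv vu] e; exists (f G v); last by rewrite -smor_star e.
by rewrite -!gmor_mul uv vu gmor_one.
Qed.
End Functoriality.

(** * Orthogonality of the constructed automorphisms *)

Lemma PA_orth_tilde (k : comPzRingType) (D : group_class) (A : star_green k D)
    (G : dobj D) (u : A G) : orthogonal_unit u -> PA_orth_aut (PA_tilde u).
Proof.
case=> v [uv vu] e; exists (PA_tilde v); last by rewrite PA_dual_tilde e.
by split; rewrite PA_tildeM ?uv ?vu PA_idE.
Qed.

(** Inflation respects composition, identities and duals, so it carries the inverse $\omega^\bullet$
    to an inverse which is again the dual. *)
Lemma PA_orth_dInf (k : comPzRingType) (D : group_class) (A : star_green k D)
    (G : dobj D) (N : {group G}) (nN : (N <| [set: G])%g)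
    (omega : PA_hom A (dobj_quo G nN) (dobj_quo G nN)) :
  PA_orth_aut omega -> PA_orth_aut (PA_dInf omega).
Proof.
case=> omega' [e1 e2] e; exists (PA_dInf omega'); last by rewrite PA_dual_dInf e.
by split; rewrite PA_dInf_comp ?e1 ?e2 PA_dInf_id.
Qed.

Theorem proposition5p8 (k : comPzRingType) (D : group_class) (A C : star_green k D)
    (f : star_green_mor A C) :
  [/\ forall (G H : dobj D) (alpha : PA_hom A G H),
        PA_map f (PA_dual alpha) = PA_dual (PA_map f alpha),
      forall G : dobj D,
        [/\ forall omega : PA_hom A G G, PA_aut omega -> PA_aut (PA_map f omega),
            forall omega : PA_hom A G G, PA_orth_aut omega -> PA_orth_aut (PA_map f omega)
          & forall omega omega' : PA_hom A G G, PA_orth_aut omega -> PA_orth_aut omega' ->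
              PA_map f (PA_comp omega omega') = PA_comp (PA_map f omega) (PA_map f omega')],
      forall (G : dobj D) (u : A G), orthogonal_unit u ->
        [/\ orthogonal_unit (f G u), PA_orth_aut (PA_tilde u), PA_orth_aut (PA_map f (PA_tilde u))
          & PA_map f (PA_tilde u) = PA_tilde (f G u)]
    & forall (G : dobj D) (N : {group G}) (nN : (N <| [set: G])%g)
        (omega : PA_hom A (dobj_quo G nN) (dobj_quo G nN)), PA_orth_aut omega ->
        [/\ PA_orth_aut (PA_map f omega), PA_orth_aut (PA_dInf omega),
            PA_orth_aut (PA_map f (PA_dInf omega))
          & PA_map f (PA_dInf omega) = PA_dInf (PA_map f omega)]].
Proof.
split=> [G H|G|G u uo|G N nN omega oo].
- exact: PA_map_dual.
- split=> [omega [omega' /(PA_map_inverse f) i]|omega|omega omega' _ _].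
  + by exists (PA_map f omega').
  + exact: PA_map_orth.
  + exact: PA_map_comp.
- have to := PA_orth_tilde uo.
  by split; [exact: orthogonal_unit_map | | exact: PA_map_orth | exact: PA_map_tilde].
- have to := PA_orth_dInf oo.
  by split; [exact: PA_map_orth | | exact: PA_map_orth | exact: PA_map_dInf].
Qed.
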